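(* Let $B>0$, let $\mathfrak b$ be a fractional ideal of $K$ and let $\operatorname{Re}(s)>1/2$. The constant Fourier coefficient ($\nu=0$) of $\tilde H_s^B(\mathfrak b,z)$ is given by $$\tilde b_s^B(\mathfrak b,0,y)=\frac{(4B)^s(y_1y_2)^{1-s}\,\mathrm B(\tfrac12,s-\tfrac12)^2}{\operatorname{vol}(\mathfrak b)}\;{}_2F_1\bigl(2s-1,\,s-\tfrac12;\,s;\,-B/(y_1y_2)\bigr).$$
   Context: $K\subset\mathbb R$ is a real quadratic field of discriminant $D$ ($\sqrt D>0$), $x\mapsto x'$ conjugation, $\mathfrak d=\sqrt D\,\mathcal O_K$; ideals are nonzero fractional ideals with norm $N(\mathfrak b)>0$, and $\operatorname{vol}(\mathfrak b)=N(\mathfrak b)\sqrt D$. $e(w)=e^{2\pi iw}$, $z=(z_1,z_2)=(x_1+iy_1,x_2+iy_2)\in\mathbb H^2$, $y=(y_1,y_2)$, $\operatorname{tr}(\nu x)=\nu x_1+\nu'x_2$. $\mathrm B(x,y)=\Gamma(x)\Gamma(y)/\Gamma(x+y)$ is the beta function and ${}_2F_1(a,b;c;z)$ the Gaussian hypergeometric function (analytically continued to $z\in\mathbb C\setminus[1,\infty)$). The function $\tilde H_s^B(\mathfrak b,z)=\sum_{\mu\in\mathfrak b}\Bigl(1+\frac{|(z_1+\mu)(z_2+\mu')+B|^2}{4y_1y_2B}\Bigr)^{-s}$ is invariant under translations by $\mathfrak b$, with Fourier expansion $\tilde H_s^B(\mathfrak b,z)=\sum_{\nu\in(\mathfrak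 b\mathfrak d)^{-1}}\tilde b_s^B(\mathfrak b,\nu,y)e(\operatorname{tr}(\nu x))$, whose coefficients are $\tilde b_s^B(\mathfrak b,\nu,y)=\frac1{\operatorname{vol}(\mathfrak b)}\int_{\mathbb R^2}\Bigl(1+\frac{|z_1z_2+B|^2}{4y_1y_2B}\Bigr)^{-s}e(-\operatorname{tr}(\nu x))\,dx_1dx_2$. *)

(* Defs.v *)
From HB Require Import structures.
From mathcomp Require Import all_boot all_order all_algebra all_field.
From mathcomp Require Import all_classical all_reals all_analysis.
From mathcomp Require Import complex.
Set Implicit Arguments.
Unset Strict Implicit.
Unset Printing Implicit Defensive.
Import Order.TTheory GRing.Theory Num.Theory.
Import numFieldNormedType.Exports.
Local Open Scope classical_set_scope.
Local Open Scope ring_scope.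
Local Open Scope complex_scope.

(* A real quadratic field is an extension [K] of [rat] of degree 2 with two
   distinct embeddings [iota], [iota'] into the reals: [iota] is the inclusion
   of K in R, and [iota' x] is the real number x'. *)
Section QuadraticField.
Context {R : realType} {K : fieldExtType rat}.
Variables iota iota' : {rmorphism K -> R}.
Implicit Types (A b : set K) (D : int).

Definition integers : set K :=
  [set x | integralOver (fun m : int => m%:~R : K) x].

(* [w1, w2] is automatically a Z-basis: the ring of integers spans [K]. *)
Definition is_discriminant D : Prop :=
  exists w1 w2 : K,
    (forall x, integers x <-> exists m n : int, x = w1 *~ m + w2 *~ n) /\
    D%:~R = (iota w1 * iota' w2 - iota w2 * iota' w1) ^+ 2.

Definition fractional_ideal b : Prop :=
  [/\ exists2 x, b x & x != 0,
      forall x y, b x -> b y -> b (x + y),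
      forall a x, integers a -> b x -> b (a * x)
    & exists d, [/\ integers d, d != 0 & forall x, b x -> integers (d * x)]].

(* [A : A'] = n for additive subgroups A' of A: n representatives [r i] of the
   cosets. *)
Definition has_index A A' (n : nat) : Prop :=
  exists r : 'I_n -> K,
    (forall i, A (r i)) /\ (forall x, A x -> exists! i, A' (x - r i)).

(* N(b) = [O_K : d b] / |d d'| for any nonzero integer d with d b in O_K. *)
Definition ideal_norm b : R :=
  xget 0 [set q | exists d n,
    [/\ integers d, d != 0, (forall x, b x -> integers (d * x)),
        has_index integers [set d * x | x in b] n
      & q = n%:R / `|iota d * iota' d| ]].

Definition vol D b : R := ideal_norm b * Num.sqrt D%:~R.

Definition tr (nu : K) (x : R * R) : R := iota nu * x.1 + iota' nu * x.2.

End QuadraticField.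

Section ComplexFunctions.
Context {R : realType}.
Implicit Types (s w z a b c : R[i]) (x : R).

Definition cexp w : R[i] :=
  (expR (complex.Re w))%:C * (cos (complex.Im w) +i* sin (complex.Im w)).

(* Used for [0 < x] only. *)
Definition cpow x s : R[i] := cexp ((ln x)%:C * s).

Definition e w : R[i] := cexp ((0 +i* (2 * pi)) * w).

Definition cintegral (d : measure_display) (T : measurableType d)
    (mu : {measure set T -> \bar R}) (A : set T) (f : T -> R[i]) : R[i] :=
  Rintegral mu A (fun t => complex.Re (f t)) +i*
  Rintegral mu A (fun t => complex.Im (f t)).

Definition euler_integral w : R[i] :=
  cintegral lebesgue_measure `]0, +oo[
    (fun t => cpow t (w - 1) * (expR (- t))%:C).

(* Euler's integral for 0 < Re w (then n = 0), continued to the other w by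
   Gamma w = Gamma (w + n) / (w (w + 1) ... (w + n - 1)) with 0 < Re (w + n). *)
Definition Gamma w : R[i] :=
  let n := Num.truncn (1 - complex.Re w) in
  euler_integral (w + n%:R) / \prod_(k < n) (w + k%:R).

Definition Beta w z : R[i] := Gamma w * Gamma z / Gamma (w + z).

Definition pochhammer a (n : nat) : R[i] := \prod_(k < n) (a + k%:R).

Definition gauss_term a b c z (n : nat) : R[i] :=
  pochhammer a n * pochhammer b n / (pochhammer c n * n`!%:R) * z ^+ n.

(* The cast selects the norm topology of [R[i]]. *)
Definition has_sum (u : nat -> R[i]) (l : R[i]) : Prop :=
  series u @ \oo --> (l : (R[i] : numFieldType)).

Definition analytic_on (U : set R[i]) (F : R[i] -> R[i]) : Prop :=
  forall z0, U z0 -> exists (u : nat -> R[i]) (r : R), 0 < r /\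
    forall z, `|z - z0| < r%:C ->
      has_sum (fun n => u n * (z - z0) ^+ n) (F z).

(* In [R[i]], [1 <= z] means that z is real and at least 1, so the domain below
   is C \ [1, +oo[, on which these two properties determine F. *)
Definition is_hyp2F1 a b c (F : R[i] -> R[i]) : Prop :=
  (forall z, `|z| < 1 -> has_sum (gauss_term a b c z) (F z)) /\
  analytic_on [set z | ~ (1 <= z)] F.

End ComplexFunctions.

Section FourierCoefficient.
Context {R : realType} {K : fieldExtType rat}.
Variables iota iota' : {rmorphism K -> R}.

(* The term at mu of the series of H^B_s(b, z) is
   [Hterm s B (z1 + mu) (z2 + mu')]. *)
Definition Hterm (s : R[i]) (B : R) (z1 z2 : R[i]) : R[i] :=
  cpow (1 + Normc.normc (z1 * z2 + B%:C) ^+ 2 /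
            (4 * complex.Im z1 * complex.Im z2 * B)) (- s).

(* The Fourier coefficient of H^B_s(b, z) at nu, as the integral over the plane
   that unfolds the sum over the lattice b. *)
Definition btilde (D : int) (b : set K) (s : R[i]) (B : R) (nu : K) (y1 y2 : R)
    : R[i] :=
  (vol iota iota' D b)^-1%:C *
  cintegral (@lebesgue_measure R \x @lebesgue_measure R)%E setT
    (fun x => Hterm s B (x.1 +i* y1) (x.2 +i* y2) *
              e (- tr iota iota' nu x)%:C).

End FourierCoefficient.

(* Main.v *)
Require Import Defs.
From HB Require Import structures.
From mathcomp Require Import all_boot all_order all_algebra all_field.
From mathcomp Require Import all_classical all_reals all_analysis.
From mathcomp Require Import complex.
From mathcomp Require Import measurable_realfun ring lra.
Set Implicit Arguments.
Unset Strict Implicit.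
Unset Printing Implicit Defensive.
Import Order.TTheory GRing.Theory Num.Theory.
Import numFieldNormedType.Exports.
Local Open Scope classical_set_scope.
Local Open Scope ring_scope.
Local Open Scope complex_scope.

(** The coefficient at nu = 0 is, up to the volume, the integral over the plane
of H = (1 + |z1 z2 + B|^2 / (4 y1 y2 B))^(-s), and the proof evaluates that
integral one variable at a time.

Put A = x1^2 + y1^2. Expanding the square and completing it in x2 gives
<<
  4 y1 y2 B + |z1 z2 + B|^2 = A (x2 + B x1 / A)^2 + (A y2 + B y1)^2 / A,
>>
so an affine substitution in x2 turns the inner integral into
P(s) = \int (1 + v^2)^(-s) dv times an explicit function of x1. With x1 = y1 u,
w = 1 / (1 + u^2) and t = B / (y1 y2), what remains is
y1 y2 (4B)^s (y1 y2)^(-s) P(s) E(t), where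
E(t) = \int (1 + u^2)^(-s) (1 + t w)^(1 - 2s) du is Euler's integral for the
hypergeometric function (the usual one after the substitution w).
Fubini applies because 1 + |z1 z2 + B|^2 / (4 y1 y2 B) is at least a constant
times (1 + (x1/y1)^2) (1 + (x2/y2)^2).

Two facts are then needed: P(s) = Beta(1/2, s - 1/2), and E(t) = P(s) F(-t).

For the first, P(s) Gamma(s) is the integral of r^(s-1) exp(- r (1 + v^2)) over
r > 0 and v; integrating in v first leaves sqrt(pi) Gamma(s - 1/2), and s = 1
shows that Gamma(1/2) = sqrt(pi). Dividing by Gamma(s) requires
[Gamma_neq0]: by the functional equation it is enough to look far to the right,
where the mass of r^(Re s - 1) exp(-r) concentrates near r = Re s, so that the
oscillating factor r^(i Im s) cannot produce cancellation.

For the second, a = 2s - 1 has positive real part, hence (1 + t w)^(-a) is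
itself a Gamma integral and Gamma(a) E(t) is the integral over the plane of
<<
  Phi_t(u, r) = (1 + u^2)^(-s) r^(a-1) exp(- r (1 + t w)).
>>
Expanding exp(- r h w) in powers of h shows that E has a power series of radius
at least 1 about every t0 >= 0 ([Phi_integral_expansion]). About t0 = 0 the
coefficients of Gamma(a) E are (-1)^n P(s + n) Gamma(a + n) / n!, which are
Gamma(a) P(s) times those of F(-t), so E(t) = P(s) F(-t) for t < 1. Since F is
only known through analyticity beyond the unit disc, the identity theorem on the
half-line ([real_analytic_eq0]) carries the equality to all t >= 0. *)

(** * Real and imaginary parts, and complex powers of positive reals *)

Section ComplexAlgebra.
Context {R : realType}.
Implicit Types (z w s : R[i]) (x y : R).

Lemma ReM z w : complex.Re (z * w) =
  complex.Re z * complex.Re w - complex.Im z * complex.Im w.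
Proof. by case: z => a b; case: w. Qed.

Lemma ImM z w : complex.Im (z * w) =
  complex.Re z * complex.Im w + complex.Im z * complex.Re w.
Proof. by case: z => a b; case: w. Qed.

Lemma ReD z w : complex.Re (z + w) = complex.Re z + complex.Re w.
Proof. by case: z => a b; case: w. Qed.

Lemma ImD z w : complex.Im (z + w) = complex.Im z + complex.Im w.
Proof. by case: z => a b; case: w. Qed.

Lemma ReN z : complex.Re (- z) = - complex.Re z.
Proof. by case: z. Qed.

Lemma ImN z : complex.Im (- z) = - complex.Im z.
Proof. by case: z. Qed.

Lemma Re_realM x z : complex.Re (x%:C * z) = x * complex.Re z.
Proof. by case: z => a b; rewrite ReM /= mul0r subr0. Qed.

Lemma Im_realM x z : complex.Im (x%:C * z) = x * complex.Im z.
Proof. by case: z => a b; rewrite ImM /= mul0r addr0. Qed.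

Lemma Re_Mreal x z : complex.Re (z * x%:C) = complex.Re z * x.
Proof. by rewrite mulrC Re_realM mulrC. Qed.

Lemma Im_Mreal x z : complex.Im (z * x%:C) = complex.Im z * x.
Proof. by rewrite mulrC Im_realM mulrC. Qed.

Lemma natrC n : n%:R = (n%:R : R)%:C.
Proof. by rewrite rmorph_nat. Qed.

Lemma Re_nat n : complex.Re (n%:R : R[i]) = n%:R.
Proof. by rewrite natrC. Qed.

Lemma Im_nat n : complex.Im (n%:R : R[i]) = 0.
Proof. by rewrite natrC. Qed.

Lemma Re_sum (I : Type) (r : seq I) (P : pred I) (F : I -> R[i]) :
  complex.Re (\sum_(i <- r | P i) F i) = \sum_(i <- r | P i) complex.Re (F i).
Proof. by elim/big_rec2: _ => // i a b _ <-; rewrite ReD. Qed.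

Lemma Im_sum (I : Type) (r : seq I) (P : pred I) (F : I -> R[i]) :
  complex.Im (\sum_(i <- r | P i) F i) = \sum_(i <- r | P i) complex.Im (F i).
Proof. by elim/big_rec2: _ => // i a b _ <-; rewrite ImD. Qed.

Lemma complex_eq z w :
  complex.Re z = complex.Re w -> complex.Im z = complex.Im w -> z = w.
Proof. by case: z => a b; case: w => c d /= -> ->. Qed.

Lemma normcE2 z :
  Normc.normc z = Num.sqrt (complex.Re z ^+ 2 + complex.Im z ^+ 2).
Proof. by case: z. Qed.

Lemma normc_ge0 z : 0 <= Normc.normc z.
Proof. by rewrite normcE2 sqrtr_ge0. Qed.

Lemma sqr_normcE z :
  Normc.normc z ^+ 2 = complex.Re z ^+ 2 + complex.Im z ^+ 2.
Proof. by rewrite normcE2 sqr_sqrtr// addr_ge0 ?sqr_ge0. Qed.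

Lemma le_Re_normc z : `|complex.Re z| <= Normc.normc z.
Proof.
by rewrite normcE2 -sqrtr_sqr ler_wsqrtr// lerDl sqr_ge0.
Qed.

Lemma le_Im_normc z : `|complex.Im z| <= Normc.normc z.
Proof.
by rewrite normcE2 -sqrtr_sqr ler_wsqrtr// lerDr sqr_ge0.
Qed.

Lemma normc_real x : Normc.normc x%:C = `|x|.
Proof. by rewrite normcE2 /= expr0n addr0 sqrtr_sqr. Qed.

Lemma cexpD z w : cexp (z + w) = cexp z * cexp w.
Proof.
rewrite /cexp ReD ImD expRD cosD sinD.
by apply: complex_eq; rewrite !(ReM, ImM) /=; ring.
Qed.

Lemma cexp0 : cexp 0 = 1 :> R[i].
Proof. by rewrite /cexp /= expR0 cos0 sin0 mul1r. Qed.

Lemma cpowD x s z : cpow x (s + z) = cpow x s * cpow x z.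
Proof. by rewrite /cpow mulrDr cexpD. Qed.

Lemma cpowMl x y s : 0 < x -> 0 < y -> cpow (x * y) s = cpow x s * cpow y s.
Proof. by move=> x0 y0; rewrite /cpow lnM// rmorphD mulrDl cexpD. Qed.

Lemma cpowVl x s : 0 < x -> cpow x^-1 s = cpow x (- s).
Proof. by move=> x0; rewrite /cpow lnV// rmorphN mulNr mulrN. Qed.

Lemma cpow_real x y : cpow x y%:C = (expR (ln x * y))%:C.
Proof.
rewrite /cpow -rmorphM /cexp /= cos0 sin0.
by apply: complex_eq; rewrite !(ReM, ImM) /=; ring.
Qed.

Lemma cpow_nat x n : 0 < x -> cpow x n%:R = (x ^+ n)%:C.
Proof.
by move=> x0; rewrite natrC cpow_real mulrC expRM_natl lnK.
Qed.

Lemma cpow1 x : 0 < x -> cpow x 1 = x%:C.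
Proof. exact: (@cpow_nat x 1%N). Qed.

Lemma Re_cpow x s :
  complex.Re (cpow x s) = expR (ln x * complex.Re s) * cos (ln x * complex.Im s).
Proof. by rewrite /cpow /cexp !(ReM, ImM) /= !mul0r !subr0 addr0. Qed.

Lemma Im_cpow x s :
  complex.Im (cpow x s) = expR (ln x * complex.Re s) * sin (ln x * complex.Im s).
Proof. by rewrite /cpow /cexp !(ReM, ImM) /= !mul0r !subr0 !addr0. Qed.

Lemma normc_cpow x s : Normc.normc (cpow x s) = expR (ln x * complex.Re s).
Proof.
rewrite normcE2 Re_cpow Im_cpow !exprMn -mulrDr cos2Dsin2 mulr1 sqrtr_sqr.
by rewrite ger0_norm// expR_ge0.
Qed.

End ComplexAlgebra.

(** * Affine substitutions in Lebesgue integrals *)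

Section AffineChange.
Context {R : realType}.
Let mu := @lebesgue_measure R.

Lemma measurable_affine (k m : R) : measurable_fun setT (fun x : R => k * x + m).
Proof. by apply: measurable_funD => //; exact: measurable_funM. Qed.

(** Lebesgue measure equals k times its image under x -> k x + m: both measures
    agree on half-open intervals, which determine it. *)
Lemma ge0_integral_affine (k m : R) (f : R -> \bar R) : 0 < k ->
  measurable_fun setT f -> (forall x, (0 <= f x)%E) ->
  (\int[mu]_x f x = k%:E * \int[mu]_x f (k * x + m)%R)%E.
Proof.
move=> k0 mf f0.
pose phi : R -> measurableTypeR R := fun x => k * x + m.
have mphi : measurable_fun setT phi := measurable_affine k m.
pose K : {nonneg R} := NngNum (ltW k0).
have numu A : measurable A -> mu A = mscale K (pushforward mu phi) A.
  move=> mA; apply: lebesgue_measure_unique => //= _ [[a b]] _ <-.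
  rewrite /mscale /= /pushforward /=.
  have -> : phi @^-1` `]a, b] = `](a - m) / k, (b - m) / k]%classic.
    apply/seteqP; split => x /=; rewrite !in_itv /= /phi ltr_pdivrMr// ler_pdivlMr//;
      move=> /andP[? ?]; apply/andP; split; lra.
  rewrite /mu !lebesgue_measure_itv /= !lte_fin ltr_pM2r ?invr_gt0// ltrD2r.
  case: ifP => _; last by rewrite mule0.
  rewrite -!EFinD -EFinM; congr EFin; field; lra.
rewrite (eq_measure_integral _ (fun A mA (_ : A `<=` setT) => numu mphi A mA)).
rewrite ge0_integral_mscale//=.
by rewrite ge0_integral_pushforward// ?preimage_setT//; exact: measurableT.
Qed.

Lemma integrable_affine (k m : R) (f : R -> R) : 0 < k ->
  mu.-integrable setT (EFin \o f) ->
  mu.-integrable setT (EFin \o (fun x => f (k * x + m))).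
Proof.
move=> k0 /integrableP[mf foo]; apply/integrableP; split.
  exact: (measurableT_comp mf (measurable_affine k m)).
move: foo; rewrite (ge0_integral_affine m k0)//.
by rewrite !ltey; apply: contra => /eqP ->; rewrite gt0_muley// lte_fin.
exact: measurableT_comp.
Qed.

Lemma Rintegral_affine (k m : R) (f : R -> R) : 0 < k ->
  mu.-integrable setT (EFin \o f) ->
  \int[mu]_x f x = k * \int[mu]_x f (k * x + m).
Proof.
move=> k0 If; have Ifk := integrable_affine m k0 If.
have mf := measurable_int _ If.
rewrite /Rintegral -[k in RHS]/(fine k%:E) -fineM//; last first.
  exact: integrable_fin_num Ifk.
congr fine; rewrite integralE [in RHS]integralE muleBr//; last first.
  exact: integrable_add_def Ifk.
have mf' : measurable_fun [set: R] (fun x => (f x)%:E) by exact: mf.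
congr (_ - _)%E.
  rewrite (ge0_integral_affine m k0 (measurable_funepos mf'))//.
  by congr (_ * _)%E; apply: eq_integral => x _; rewrite !funeposE.
rewrite (ge0_integral_affine m k0 (measurable_funeneg mf'))//.
by congr (_ * _)%E; apply: eq_integral => x _; rewrite !funenegE.
Qed.

End AffineChange.

(** * Integrals of complex-valued functions *)

Section ComplexMeasurable.
Context {d} {T : measurableType d} {R : realType}.
Implicit Types (f g : T -> R[i]) (h : T -> R).

Definition cmeasurable f :=
  measurable_fun setT (fun x => complex.Re (f x)) /\
  measurable_fun setT (fun x => complex.Im (f x)).

Lemma cmeasurable_cst (c : R[i]) : cmeasurable (fun=> c).
Proof. by split; exact: measurable_cst. Qed.

Lemma cmeasurable_real h : measurable_fun setT h -> cmeasurable (fun x => (h x)%:C).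
Proof. by move=> mh; split => //; exact: measurable_cst. Qed.

Lemma cmeasurableM f g : cmeasurable f -> cmeasurable g ->
  cmeasurable (fun x => f x * g x).
Proof.
move=> [f1 f2] [g1 g2]; split.
- by under eq_fun do rewrite ReM; apply: measurable_funB; exact: measurable_funM.
- by under eq_fun do rewrite ImM; apply: measurable_funD; exact: measurable_funM.
Qed.

Lemma cmeasurable_cpow h (s : R[i]) : measurable_fun setT h ->
  cmeasurable (fun x => cpow (h x) s).
Proof.
move=> mh; have mln (c : R) : measurable_fun setT (fun x => ln (h x) * c).
  by apply: measurable_funM => //; exact: measurableT_comp.
split.
- under eq_fun do rewrite Re_cpow; apply: measurable_funM.
    by apply: measurableT_comp => //; exact: measurable_expR.
  apply: measurableT_comp => //; apply: continuous_measurable_fun.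
  exact: continuous_cos.
- under eq_fun do rewrite Im_cpow; apply: measurable_funM.
    by apply: measurableT_comp => //; exact: measurable_expR.
  apply: measurableT_comp => //; apply: continuous_measurable_fun.
  exact: continuous_sin.
Qed.

Lemma cmeasurable_if (b : T -> bool) f g : measurable_fun setT b ->
  cmeasurable f -> cmeasurable g -> cmeasurable (fun x => if b x then f x else g x).
Proof.
move=> mb [f1 f2] [g1 g2]; split.
- by under eq_fun do rewrite (fun_if (@complex.Re R)); exact: measurable_fun_ifT.
- by under eq_fun do rewrite (fun_if (@complex.Im R)); exact: measurable_fun_ifT.
Qed.

Lemma measurable_normc f : cmeasurable f ->
  measurable_fun setT (fun x => Normc.normc (f x)).
Proof.
move=> [f1 f2]; under eq_fun do rewrite normcE2.
apply: measurableT_comp; first exact: continuous_measurable_fun (@sqrt_continuous R).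
by apply: measurable_funD; exact: measurable_funX.
Qed.

Definition cintegrable (mu : set T -> \bar R) f :=
  mu.-integrable setT (EFin \o (fun x => complex.Re (f x))) /\
  mu.-integrable setT (EFin \o (fun x => complex.Im (f x))).

Variable mu : {measure set T -> \bar R}.

Lemma cintegrable_measurable f : cintegrable mu f -> cmeasurable f.
Proof.
by case=> /integrableP[/measurable_EFinP ? _] /integrableP[/measurable_EFinP ? _].
Qed.

(** The only integrability criterion used below: the modulus controls both
    components. *)
Lemma cintegrable_le f h : cmeasurable f ->
  mu.-integrable setT (EFin \o h) -> (forall x, Normc.normc (f x) <= h x) ->
  cintegrable mu f.
Proof.
move=> [f1 f2] Ih fh; split; apply: le_integrable Ih => //;
  try exact/measurable_EFinP; move=> x _; rewrite /= lee_fin.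
- exact: le_trans (le_trans (le_Re_normc _) (fh x)) (ler_norm _).
- exact: le_trans (le_trans (le_Im_normc _) (fh x)) (ler_norm _).
Qed.

Lemma integrable_normc f : cintegrable mu f ->
  mu.-integrable setT (EFin \o (fun x => Normc.normc (f x))).
Proof.
move=> If; have mf := cintegrable_measurable If; case: If => I1 I2.
have Ih : mu.-integrable setT
    (EFin \o (fun x => `|complex.Re (f x)| + `|complex.Im (f x)|)).
  exact: (integrableD measurableT (integrable_norm I1) (integrable_norm I2)).
apply: le_integrable Ih => //.
  by apply/measurable_EFinP; exact: measurable_normc.
move=> x _ /=; rewrite lee_fin ger0_norm ?normc_ge0// ger0_norm ?addr_ge0//.
rewrite -ler_sqr ?nnegrE ?normc_ge0 ?addr_ge0// sqr_normcE sqrrD.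
by rewrite !real_normK ?num_real// addrAC lerDl mulrn_wge0// mulr_ge0.
Qed.

Lemma eq_cintegral f g : f =1 g -> cintegral mu setT f = cintegral mu setT g.
Proof. by move=> /funext ->. Qed.

Lemma cintegral_Re (D : set T) f :
  complex.Re (cintegral mu D f) = \int[mu]_(t in D) complex.Re (f t).
Proof. by []. Qed.

Lemma cintegralZl (c : R[i]) f : cintegrable mu f ->
  cintegral mu setT (fun x => c * f x) = c * cintegral mu setT f.
Proof.
move=> [I1 I2]; apply: complex_eq; rewrite /cintegral /= ?ReM ?ImM /=.
- under eq_Rintegral do rewrite ReM.
  by rewrite RintegralB ?RintegralZl//;
    (exact: (integrableZl measurableT _ I1) || exact: (integrableZl measurableT _ I2)).
- under eq_Rintegral do rewrite ImM.
  by rewrite RintegralD ?RintegralZl//;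
    (exact: (integrableZl measurableT _ I1) || exact: (integrableZl measurableT _ I2)).
Qed.

Lemma cintegrableZl (c : R[i]) f : cintegrable mu f -> cintegrable mu (fun x => c * f x).
Proof.
move=> If; apply: (@cintegrable_le _ (fun x => Normc.normc c * Normc.normc (f x))).
- by apply: cmeasurableM; [exact: cmeasurable_cst|exact: cintegrable_measurable].
- exact: (integrableZl measurableT _ (integrable_normc If)).
- by move=> x; rewrite Normc.normcM.
Qed.

End ComplexMeasurable.

Section Series.
Context {d} {T : measurableType d} {R : realType}.
Variable mu : {measure set T -> \bar R}.

(** Dominated convergence for the partial sums. *)
Lemma Rintegral_series (f : nat -> T -> R) (F g : T -> R) :
  (forall n, mu.-integrable setT (EFin \o f n)) ->
  (forall x, series (f ^~ x) n @[n --> \oo] --> F x) ->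
  mu.-integrable setT (EFin \o g) ->
  (forall x n, `|series (f ^~ x) n| <= g x) ->
  series (fun n => \int[mu]_x f n x) n @[n --> \oo] --> \int[mu]_x F x.
Proof.
move=> If fF Ig fg.
have Is n : mu.-integrable setT (EFin \o (fun x => series (f ^~ x) n)).
  rewrite (_ : _ \o _ = (fun x => (\sum_(0 <= k < n) (f k x)%:E)%E)); last first.
    by apply/funext => x /=; rewrite sumEFin.
  by apply: integrable_sum => // i _; exact: If.
have IS : mu.-integrable setT (EFin \o F).
  apply: le_integrable Ig => //.
    apply/measurable_EFinP.
    apply: (@measurable_fun_cvg _ _ _ setT (fun n x => series (f ^~ x) n)) => //.
    by move=> n; apply/measurable_EFinP; exact: measurable_int (Is n).
  move=> x _ /=; rewrite lee_fin (le_trans _ (ler_norm _))//.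
  have /cvg_norm := fF x; move=> /cvg_lim <-//; apply: limr_le; last by near=> n.
  by apply: is_cvg_norm; apply/cvg_ex; exists (F x).
have -> : series (fun n => \int[mu]_x f n x) =
    (fun n => fine (\int[mu]_x (series (f ^~ x) n)%:E)%E).
  apply/funext => n; rewrite /series /= /Rintegral sum_fine; last first.
    by move=> k _; exact: (integrable_fin_num measurableT (If k)).
  rewrite -integral_sum//.
  by congr fine; apply: eq_integral => x _; rewrite sumEFin.
rewrite /Rintegral; apply: fine_cvg; rewrite fineK; last first.
  exact: (integrable_fin_num measurableT IS).
apply: (@dominated_cvg _ _ _ _ _ measurableT _ _ (EFin \o g)) => //.
- by move=> n; exact: measurable_int (Is n).
- by move=> x _; apply: cvg_EFin; [exact: nearW|exact: fF].
- by move=> n x _; rewrite /= lee_fin.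
Unshelve. all: end_near. Qed.
End Series.

Section ComplexLimit.
Context {R : realType}.
Implicit Types (u v : nat -> R[i]) (l c : R[i]).

(** Convergence in the complex plane by components, so that limit theorems for
    real sequences apply. *)
Definition ccvg u l :=
  (complex.Re (u n) @[n --> \oo] --> complex.Re l) /\
  (complex.Im (u n) @[n --> \oo] --> complex.Im l).

Lemma ccvg_unique u l l' : ccvg u l -> ccvg u l' -> l = l'.
Proof.
by move=> [u1 u2] [v1 v2]; apply: complex_eq;
  [exact: (cvg_unique _ u1 v1)|exact: (cvg_unique _ u2 v2)].
Qed.

Lemma ccvgM u v l l' : ccvg u l -> ccvg v l' -> ccvg (fun n => u n * v n) (l * l').
Proof.
move=> [u1 u2] [v1 v2]; split.
- by under eq_fun do rewrite ReM; rewrite ReM; apply: cvgB; exact: cvgM.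
- by under eq_fun do rewrite ImM; rewrite ImM; apply: cvgD; exact: cvgM.
Qed.

Lemma ccvgB u v l l' : ccvg u l -> ccvg v l' -> ccvg (fun n => u n - v n) (l - l').
Proof.
move=> [u1 u2] [v1 v2]; split.
- by under eq_fun do rewrite ReD ReN; rewrite ReD ReN; exact: cvgB.
- by under eq_fun do rewrite ImD ImN; rewrite ImD ImN; exact: cvgB.
Qed.

Lemma ccvg_cst c : ccvg (fun=> c) c.
Proof. by split; exact: cvg_cst. Qed.

Lemma ccvg_real (u : nat -> R) (l : R) :
  u n @[n --> \oo] --> l -> ccvg (fun n => (u n)%:C) l%:C.
Proof. by move=> ul; split => //; exact: cvg_cst. Qed.

Lemma ccvg_seriesZl c u l : ccvg (series u) l -> ccvg (series (fun n => c * u n)) (c * l).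
Proof.
move=> ul; rewrite (_ : series _ = fun n => c * series u n); last first.
  by apply/funext => n; rewrite /series /= mulr_sumr.
exact: ccvgM (ccvg_cst c) ul.
Qed.

Lemma has_sum_ccvg u l : has_sum u l -> ccvg (series u) l.
Proof.
rewrite /has_sum => /(@cvgrPdist_lt _ ((R[i] : numFieldType) : normedModType _)) ul.
split; apply/cvgrPdist_lt => eps eps0.
- have /ul : 0 < eps%:C by rewrite ltcR.
  apply: filterS => n; rewrite normc_def ltcR; apply: le_lt_trans.
  by rewrite -ReN -ReD -normcE2 le_Re_normc.
- have /ul : 0 < eps%:C by rewrite ltcR.
  apply: filterS => n; rewrite normc_def ltcR; apply: le_lt_trans.
  by rewrite -ImN -ImD -normcE2 le_Im_normc.
Qed.

End ComplexLimit.

Section ComplexSeries.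
Context {d} {T : measurableType d} {R : realType}.
Variable mu : {measure set T -> \bar R}.

(** Domination is asked of the sums of moduli, which also makes every term
    integrable. *)
Lemma cintegral_series (f : nat -> T -> R[i]) (F : T -> R[i]) (g : T -> R) :
  (forall n, cmeasurable (f n)) ->
  (forall x, ccvg (series (f ^~ x)) (F x)) ->
  mu.-integrable setT (EFin \o g) ->
  (forall x n, \sum_(0 <= k < n) Normc.normc (f k x) <= g x) ->
  ccvg (series (fun n => cintegral mu setT (f n))) (cintegral mu setT F).
Proof.
move=> mf fF Ig fg.
have If n : cintegrable mu (f n).
  apply: (cintegrable_le (mf n) Ig) => x; apply: le_trans (fg x n.+1).
  by rewrite big_nat_recr//= lerDr sumr_ge0// => k _; exact: normc_ge0.
split.
- under eq_fun do rewrite /series /= Re_sum.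
  apply: (@Rintegral_series _ _ _ _ _ _ g) => //.
  + by move=> n; exact: (If n).1.
  + by move=> x; have [h _] := fF x; under eq_fun do rewrite /series /= -Re_sum.
  + move=> x n; apply: le_trans (fg x n); apply: le_trans (ler_norm_sum _ _ _) _.
    by apply: ler_sum => k _; exact: le_Re_normc.
- under eq_fun do rewrite /series /= Im_sum.
  apply: (@Rintegral_series _ _ _ _ _ _ g) => //.
  + by move=> n; exact: (If n).2.
  + by move=> x; have [_ h] := fF x; under eq_fun do rewrite /series /= -Im_sum.
  + move=> x n; apply: le_trans (fg x n); apply: le_trans (ler_norm_sum _ _ _) _.
    by apply: ler_sum => k _; exact: le_Im_normc.
Qed.

End ComplexSeries.

Section ComplexFubini.
Context {d1 d2} {T1 : measurableType d1} {T2 : measurableType d2} {R : realType}.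
Variables (m1 : {sigma_finite_measure set T1 -> \bar R})
  (m2 : {sigma_finite_measure set T2 -> \bar R}).

Lemma Rintegral_fubini12 (f : T1 * T2 -> R) :
  (m1 \x m2)%E.-integrable setT (EFin \o f) ->
  (forall x, m2.-integrable setT (EFin \o (fun y => f (x, y)))) ->
  \int[(m1 \x m2)%E]_p f p = \int[m1]_x \int[m2]_y f (x, y).
Proof.
move=> If If2; rewrite {1}/Rintegral -(integral12_prod_meas1 If).
congr fine; apply: eq_integral => x _.
by rewrite /Rintegral fineK//; exact: (integrable_fin_num measurableT (If2 x)).
Qed.

Lemma Rintegral_fubini21 (f : T1 * T2 -> R) :
  (m1 \x m2)%E.-integrable setT (EFin \o f) ->
  (forall y, m1.-integrable setT (EFin \o (fun x => f (x, y)))) ->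
  \int[(m1 \x m2)%E]_p f p = \int[m2]_y \int[m1]_x f (x, y).
Proof.
move=> If If2; rewrite {1}/Rintegral -(integral21_prod_meas1 If).
congr fine; apply: eq_integral => x _.
by rewrite /Rintegral fineK//; exact: (integrable_fin_num measurableT (If2 x)).
Qed.

Lemma cintegral_fubini12 (f : T1 * T2 -> R[i]) :
  cintegrable (m1 \x m2)%E f ->
  (forall x, cintegrable m2 (fun y => f (x, y))) ->
  cintegral (m1 \x m2)%E setT f =
  cintegral m1 setT (fun x => cintegral m2 setT (fun y => f (x, y))).
Proof.
move=> [I1 I2] If2; rewrite /cintegral; congr (_ +i* _).
- by rewrite Rintegral_fubini12// => x; exact: (If2 x).1.
- by rewrite Rintegral_fubini12// => x; exact: (If2 x).2.
Qed.

Lemma cintegral_fubini21 (f : T1 * T2 -> R[i]) :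
  cintegrable (m1 \x m2)%E f ->
  (forall y, cintegrable m1 (fun x => f (x, y))) ->
  cintegral (m1 \x m2)%E setT f =
  cintegral m2 setT (fun y => cintegral m1 setT (fun x => f (x, y))).
Proof.
move=> [I1 I2] If2; rewrite /cintegral; congr (_ +i* _).
- by rewrite Rintegral_fubini21// => x; exact: (If2 x).1.
- by rewrite Rintegral_fubini21// => x; exact: (If2 x).2.
Qed.

Lemma integrable_prod (g : T1 -> R) (h : T2 -> R) :
  m1.-integrable setT (EFin \o g) -> m2.-integrable setT (EFin \o h) ->
  (m1 \x m2)%E.-integrable setT (EFin \o (fun p => g p.1 * h p.2)).
Proof.
move=> Ig Ih.
have mg : measurable_fun setT g by apply/measurable_EFinP; exact: measurable_int Ig.
have mh : measurable_fun setT h by apply/measurable_EFinP; exact: measurable_int Ih.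
apply/integrable12ltyP.
  by apply/measurable_EFinP; apply: measurable_funM; exact: measurableT_comp.
have /integrableP[_ goo] := Ig; have /integrableP[_ hoo] := Ih.
under eq_integral => x _.
  under eq_integral => y _ do rewrite /= normrM EFinM.
  rewrite ge0_integralZl//=; last first.
    by apply/measurable_EFinP; exact: measurableT_comp.
  over.
rewrite ge0_integralZr//=; last 2 first.
- by apply/measurable_EFinP; exact: measurableT_comp.
- exact: integral_ge0.
by rewrite lte_mul_pinfty// ?integral_ge0// ge0_fin_numE// integral_ge0.
Qed.

End ComplexFubini.

Section ComplexAffine.
Context {R : realType}.
Let mu := @lebesgue_measure R.

Lemma cintegrable_affine (k m : R) (f : R -> R[i]) : 0 < k ->
  cintegrable mu f -> cintegrable mu (fun x => f (k * x + m)).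
Proof.
by move=> k0 [I1 I2]; split;
  [exact: (integrable_affine m k0 I1)|exact: (integrable_affine m k0 I2)].
Qed.

Lemma cintegral_affine (k m : R) (f : R -> R[i]) : 0 < k -> cintegrable mu f ->
  cintegral mu setT f = k%:C * cintegral mu setT (fun x => f (k * x + m)).
Proof.
move=> k0 [I1 I2]; apply: complex_eq; rewrite ?ReM ?ImM /= mul0r ?subr0 ?addr0.
- exact: Rintegral_affine.
- exact: Rintegral_affine.
Qed.

End ComplexAffine.

(** * The integrand of the Gamma function *)

Section ImproperFTC.
Context {R : realType}.
Let mu := @lebesgue_measure R.

(** The integral of f over [1/(n+1), n+1] is a difference of two values of its
    primitive, hence at most 2 M, and these intervals exhaust the half-line. *)
Lemma ge0_integrable_derivative_0y (f F : R -> R) (M : R) :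
  (forall x : R, 0 < x -> 0 <= f x) ->
  {in `]0, +oo[%R, continuous f} ->
  (forall x : R, 0 < x -> is_derive x 1 F (f x)) ->
  (forall x : R, 0 < x -> `|F x| <= M) ->
  mu.-integrable `]0, +oo[%classic (EFin \o f).
Proof.
move=> f0 cf dF FM.
have mf : measurable_fun (`]0, +oo[%classic : set R) f.
  apply: open_continuous_measurable_fun => // x.
  by rewrite inE /= => /cf.
apply/integrableP; split; first exact/measurable_EFinP.
pose A (n : nat) : set R := `[n.+1%:R^-1, n.+1%:R]%classic.
have Apos n x : A n x -> 0 < x.
  by rewrite /A /= in_itv /= => /andP[+ _]; apply: lt_le_trans; rewrite invr_gt0.
have subA n : A n `<=` `]0, +oo[%classic.
  by move=> x /Apos x0; rewrite /= in_itv /= x0.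
have UA : \bigcup_n A n = `]0, +oo[%classic.
  apply/seteqP; split => [x [n _]|x]; first exact: subA.
  rewrite /= in_itv /= andbT => x0.
  pose n := (Num.truncn x + Num.truncn x^-1)%N.
  exists n => //; rewrite /A /= in_itv /= invf_ple ?posrE//; apply/andP; split.
    apply: le_trans (ltW (truncnS_gt _)) _; rewrite ler_nat ltnS; exact: leq_addl.
  apply: le_trans (ltW (truncnS_gt _)) _; rewrite ler_nat ltnS; exact: leq_addr.
have -> : (\int[mu]_(x in `]0%R, +oo[) `|(EFin \o f) x| =
    \int[mu]_(x in `]0%R, +oo[) (EFin \o f) x)%E.
  apply: eq_integral => x; rewrite inE /= in_itv /= andbT => x0.
  by rewrite ger0_norm// f0.
rewrite -UA; apply: (@le_lt_trans _ _ (2 * M)%:E); last exact: ltry.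
have nA : nondecreasing_seq A.
  apply/nondecreasing_seqP => n; rewrite subsetEset => x.
  rewrite /A /= !in_itv /= => /andP[h1 h2]; apply/andP; split.
    by apply: le_trans h1; rewrite lef_pV2 ?posrE// ler_nat.
  by apply: le_trans h2 _; rewrite ler_nat.
have mA i : measurable (A i) by exact: measurable_itv.
have mfA i : measurable_fun (A i) (EFin \o f).
  by apply/measurable_EFinP; apply: measurable_funS mf => //; exact: subA.
have f0A i x : A i x -> (0 <= (EFin \o f) x)%E.
  by move=> /Apos x0; rewrite lee_fin f0.
have cvgA : (\int[mu]_(x in A i) (EFin \o f) x @[i --> \oo] -->
    \int[mu]_(x in \bigcup_i A i) (EFin \o f) x)%E.
  exact: ge0_nondecreasing_set_cvg_integral.
rewrite -(cvg_lim _ cvgA)//; apply: lime_le; first by apply/cvg_ex; eexists; exact: cvgA.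
near=> n.
have n1 : (n.+1%:R^-1 : R) < n.+1%:R.
  near: n; exists 1%N => // m /= m1.
  by apply: (@lt_le_trans _ _ 1); rewrite ?invf_lt1// ?ltr1n ?ler1n.
have cF x : 0 < x -> {for x, continuous F}.
  move=> x0; apply: differentiable_continuous; apply/derivable1_diffP.
  by have [] := dF x x0.
have pn : 0 < (n.+1%:R^-1 : R) by rewrite invr_gt0.
rewrite (@continuous_FTC2 _ f F)//.
- rewrite -EFinB lee_fin (le_trans (ler_norm _))// (le_trans (ler_normB _ _))//.
  by rewrite mulr_natl mulr2n lerD// FM.
- apply: continuous_in_subspaceT => x; rewrite inE => /Apos x0; apply: cf.
  by rewrite in_itv /= x0.
- split.
  + move=> x; rewrite in_itv /= => /andP[h _].
    by have [] := dF x (lt_trans pn h).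
  + by apply: cvg_at_right_filter; exact: cF.
  + by apply: cvg_at_left_filter; apply: cF; exact: lt_trans pn n1.
- move=> x; rewrite in_itv /= => /andP[h _].
  by have [_ <-] := dF x (lt_trans pn h); rewrite derive1E.
Unshelve. all: end_near. Qed.

End ImproperFTC.

Section GammaKernel.
Context {R : realType}.
Let mu := @lebesgue_measure R.
Implicit Types (z : R[i]) (a p r x : R).

Lemma ln_rpow_derive a x : 0 < x ->
  is_derive x 1 (fun r => expR (ln r * a)) (a * expR (ln x * (a - 1))).
Proof.
move=> x0; have dln := is_derive1_ln x0.
have dlna : is_derive x 1 (fun r => ln r * a) (x^-1 * a).
  by apply: is_derive_eq; rewrite scaler0 add0r; exact: mulrC.
have := @is_derive1_comp _ expR (fun r => ln r * a) x _ _ (is_derive_expR _) dlna.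
move=> h; apply: (is_derive_eq h).
rewrite mulrBr mulr1 expRB lnK ?posrE//; ring.
Qed.

(** An exponential beats every power; the square is the denominator of the
    integrable function compared with the kernel in [rgamma_kernel_integrable]. *)
Lemma expR_dominates a p : 0 <= a -> 0 < p ->
  exists2 C, 0 < C & forall r, 0 < r -> (1 + expR (ln r * a)) ^+ 2 <= C * expR (p * r).
Proof.
move=> a0 p0; pose n := Num.truncn a; pose c := 2 + n.+1`!%:R * (2 / p) ^+ n.+1.
have c0 : 0 < c.
  by rewrite ltr_pwDl// mulr_ge0// exprn_ge0// divr_ge0// ltW.
exists (c ^+ 2) => [|r r0]; first by rewrite exprn_gt0.
have -> : p * r = p / 2 * r + p / 2 * r by field.
rewrite expRD -expr2 -exprMn lerXn2r ?nnegrE ?addr_ge0 ?mulr_ge0 ?expR_ge0 ?(ltW c0)//.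
have pr0 : 0 <= p / 2 * r by rewrite mulr_ge0 ?divr_ge0 ?ltW.
have h1 : 1 <= expR (p / 2 * r) by rewrite -[leLHS]expR0 ler_expR.
have h2 : (p / 2 * r) ^+ n.+1 / n.+1`!%:R <= expR (p / 2 * r).
  by apply: le_trans (expR_ge1Dxn n pr0); rewrite lerDr.
have h3 : expR (ln r * a) <= 1 + r ^+ n.+1.
  have [r1|r1] := leP r 1.
    apply: (@le_trans _ _ 1); last by rewrite lerDl exprn_ge0// ltW.
    rewrite -[leRHS]expR0 ler_expR.
    by rewrite mulr_le0_ge0// ln_le0.
  apply: (@le_trans _ _ (r ^+ n.+1)); last by rewrite lerDr.
  rewrite -{2}(lnK r0) -expRM_natr ler_expR.
  by rewrite ler_wpM2l ?ln_ge0 ?ltW// truncnS_gt.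
have h4 : r ^+ n.+1 <= n.+1`!%:R * (2 / p) ^+ n.+1 * expR (p / 2 * r).
  move: h2; rewrite ler_pdivrMr ?ltr0n ?fact_gt0// => h2.
  have -> : r ^+ n.+1 = (2 / p) ^+ n.+1 * (p / 2 * r) ^+ n.+1.
    by rewrite -exprMn; congr (_ ^+ _); field; lra.
  rewrite -[leRHS]mulrA [leRHS]mulrCA ler_pM2l ?exprn_gt0 ?divr_gt0//.
  by rewrite [leRHS]mulrC.
rewrite /c mulrDl; apply: le_trans (lerD (lexx _) h3) _.
rewrite addrA; apply: lerD => //; lra.
Qed.

(** The modulus of [gamma_kernel]. *)
Definition rgamma_kernel a p r : R :=
  if 0 < r then expR (ln r * (a - 1)) * expR (- (p * r)) else 0.

(** Extended by 0 to the whole line so that Fubini can be used on the plane; the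
    parameter p is the scale in exp(- p r). *)
Definition gamma_kernel z p r : R[i] :=
  if 0 < r then cpow r (z - 1) * (expR (- (p * r)))%:C else 0.

Lemma normc_gamma_kernel z p r :
  Normc.normc (gamma_kernel z p r) = rgamma_kernel (complex.Re z) p r.
Proof.
rewrite /gamma_kernel /rgamma_kernel; case: ifP => _; last by rewrite normc_real normr0.
rewrite Normc.normcM normc_cpow normc_real ger0_norm ?expR_ge0//.
by rewrite ReD ReN.
Qed.

Lemma rgamma_kernel_ge0 a p r : 0 <= rgamma_kernel a p r.
Proof. by rewrite /rgamma_kernel; case: ifP => // _; rewrite mulr_ge0 ?expR_ge0. Qed.

Lemma gamma_kernel_real a p r : gamma_kernel a%:C p r = (rgamma_kernel a p r)%:C.
Proof.
rewrite /gamma_kernel /rgamma_kernel; case: ifP => _ //.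
have -> : a%:C - 1 = (a - 1)%:C by rewrite rmorphB.
by rewrite cpow_real rmorphM.
Qed.

Lemma cmeasurable_gamma_kernel d (T : measurableType d) z (h g : T -> R) :
  measurable_fun setT h -> measurable_fun setT g ->
  cmeasurable (fun t => gamma_kernel z (h t) (g t)).
Proof.
move=> mh mg; apply: cmeasurable_if; last exact: cmeasurable_cst.
  exact: measurable_fun_ltr.
apply: cmeasurableM; first exact: cmeasurable_cpow.
apply: cmeasurable_real; apply: measurableT_comp; first exact: measurable_expR.
by apply: measurableT_comp => //; exact: measurable_funM.
Qed.

Lemma gamma_kernel_measurable z p : cmeasurable (gamma_kernel z p).
Proof. exact: cmeasurable_gamma_kernel. Qed.

Lemma measurable_rgamma_kernel d (T : measurableType d) a (h g : T -> R) :
  measurable_fun setT h -> measurable_fun setT g ->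
  measurable_fun setT (fun t => rgamma_kernel a (h t) (g t)).
Proof.
move=> mh mg; have [+ _] := cmeasurable_gamma_kernel a%:C mh mg.
by under eq_fun do rewrite gamma_kernel_real.
Qed.

(** The kernel is dominated by a multiple of r^(a-1) / (1 + r^a)^2, the derivative
    of the bounded function - 1 / (a (1 + r^a)). *)
Lemma rgamma_kernel_integrable a p : 0 < a -> 0 < p ->
  mu.-integrable setT (EFin \o rgamma_kernel a p).
Proof.
move=> a0 p0; have [C C0 hC] := expR_dominates (ltW a0) p0.
pose E r := expR (ln r * a).
pose h r := expR (ln r * (a - 1)) * (1 + E r) ^- 2.
have E1 r : 0 < 1 + E r by rewrite addr_gt0// expR_gt0.
have dE r : 0 < r -> is_derive r 1 E (a * expR (ln r * (a - 1))).
  exact: ln_rpow_derive.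
have Ih : mu.-integrable `]0, +oo[%classic (EFin \o h).
  apply: (@ge0_integrable_derivative_0y _ h (fun r => - a^-1 * (1 + E r)^-1) a^-1).
  - by move=> r _; rewrite mulr_ge0 ?expR_ge0// invr_ge0 exprn_ge0// ltW.
  - move=> r; rewrite in_itv /= andbT => r0.
    have cln : {for r, continuous (@ln R)} by exact: continuous_ln.
    have cE b : {for r, continuous (fun r => expR (ln r * b))}.
      apply: (@continuous_comp _ _ _ (fun r => ln r * b) expR); last exact: continuous_expR.
      by apply: cvgM => //; exact: cvg_cst.
    apply: cvgM; first exact: cE.
    apply: cvgV; first by rewrite expf_neq0// gt_eqF.
    by apply: cvgM; apply: cvgD; try exact: cvg_cst; exact: cE.
  - move=> r r0; have dEr := dE r r0.
    have d1E : is_derive r 1 (fun r => 1 + E r) (a * expR (ln r * (a - 1))).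
      by apply: is_derive_eq; rewrite add0r mul1r.
    have E0 : (fun r => 1 + E r) r != 0 by rewrite gt_eqF.
    apply: is_derive_eq; rewrite /GRing.scale /= /h; field.
    by rewrite (gt_eqF a0) (gt_eqF (E1 r)).
  - move=> r _; rewrite normrM normrN [`|a^-1|]ger0_norm ?invr_ge0 ?(ltW a0)//.
    rewrite ger_pMr ?invr_gt0// ger0_norm ?invr_ge0 ?(ltW (E1 r))//.
    by rewrite invf_le1// lerDl expR_ge0.
rewrite (_ : _ \o _ = ((EFin \o
    (fun r => expR (ln r * (a - 1)) * expR (- (p * r)))) \_ `]0, +oo[)); last first.
  apply/funext => r; rewrite /rgamma_kernel /= patchE; case: ifPn => r0.
    by rewrite mem_set//= in_itv /= r0.
  by rewrite memNset//= in_itv /= andbT; exact/negP.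
apply: (iffLR (integrable_mkcond _ _)) => //.
have ICh : mu.-integrable `]0, +oo[%classic (fun x => C%:E * (EFin \o h) x)%E.
  by apply: integrableZl.
apply: le_integrable ICh => //.
  apply/measurable_EFinP; apply: measurable_funTS.
  apply: measurable_funM; apply: measurableT_comp => //; first exact: measurable_funM.
  by apply: measurableT_comp => //; exact: measurable_funM.
move=> r /=; rewrite in_itv /= andbT => r0; rewrite lee_fin.
rewrite !ger0_norm ?mulr_ge0 ?expR_ge0 ?invr_ge0 ?exprn_ge0 ?(ltW C0) ?(ltW (E1 r))//.
rewrite /h mulrCA ler_pM2l ?expR_gt0// expRN ler_pdivlMr ?exprn_gt0//.
by rewrite mulrC ler_pdivrMr ?expR_gt0// hC.
Qed.

End GammaKernel.

(** * The Gamma function on the right half-plane *)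

Section GammaFunction.
Context {R : realType}.
Let mu := @lebesgue_measure R.
Implicit Types (z : R[i]) (a p r x : R).

Lemma gamma_kernel_integrable z p : 0 < complex.Re z -> 0 < p ->
  cintegrable mu (gamma_kernel z p).
Proof.
move=> z0 p0; apply: (@cintegrable_le _ _ _ mu _ (rgamma_kernel (complex.Re z) p)).
- exact: gamma_kernel_measurable.
- exact: rgamma_kernel_integrable.
- by move=> r; rewrite normc_gamma_kernel.
Qed.

Lemma GammaE z : 0 < complex.Re z -> Gamma z = cintegral mu setT (gamma_kernel z 1).
Proof.
move=> z0; rewrite /Gamma.
have -> : Num.truncn (1 - complex.Re z) = 0%N.
  by apply/truncn0Pn; rewrite -ltNge; lra.
rewrite big_ord0 divr1 addr0 /euler_integral /cintegral.
congr (_ +i* _); rewrite Rintegral_mkcond; apply: eq_Rintegral => r _;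
  rewrite patchE /gamma_kernel; case: ifPn => r0.
- by move: r0; rewrite inE /= in_itv /= andbT => ->; rewrite mul1r.
- by move: r0; rewrite notin_setE /= in_itv /= andbT => /negP/negbTE ->.
- by move: r0; rewrite inE /= in_itv /= andbT => ->; rewrite mul1r.
- by move: r0; rewrite notin_setE /= in_itv /= andbT => /negP/negbTE ->.
Qed.

(** Substituting r / p for r pulls out p^(-z). *)
Lemma cintegral_gamma_kernel z p : 0 < complex.Re z -> 0 < p ->
  cintegral mu setT (gamma_kernel z p) = cpow p (- z) * Gamma z.
Proof.
move=> z0 p0; have p'0 : 0 < p^-1 by rewrite invr_gt0.
rewrite (cintegral_affine 0 p'0)//; last exact: gamma_kernel_integrable.
transitivity (p^-1%:C * cintegral mu setT (fun r => cpow p (1 - z) * gamma_kernel z 1 r)).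
  congr (_ * _); apply: eq_cintegral => r; rewrite /gamma_kernel addr0 pmulr_rgt0//.
  case: ifPn => r0; last by rewrite mulr0.
  rewrite cpowMl// cpowVl// opprB -mulrA mul1r; congr (_ * (_ * (expR (- _))%:C)).
  by field; lra.
rewrite cintegralZl; last exact: gamma_kernel_integrable.
rewrite -GammaE// mulrA; congr (_ * _).
have -> : p^-1%:C = cpow p (- 1) by rewrite -cpowVl// cpow1.
by rewrite -cpowD; congr cpow; ring.
Qed.

(** Differentiation under the integral sign at p = 1; on ]1/2, 2[ the derivative
    in p is dominated by the kernel of exponent a + 1 and scale 1/2. *)
Lemma laplace_derive (g : R -> R) a : 0 < a -> measurable_fun setT g ->
  (forall r, 0 < r -> `|g r| <= expR (ln r * (a - 1))) ->
  is_derive (1 : R) 1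
    (fun p => \int[mu]_r (if 0 < r then g r * expR (- (p * r)) else 0))
    (\int[mu]_r (if 0 < r then - (r * g r) * expR (- r) else 0)).
Proof.
move=> a0 mg gb; pose f p r := if 0 < r then g r * expR (- (p * r)) else 0.
have mf p : measurable_fun setT (f p).
  apply: measurable_fun_ifT => //; first exact: measurable_fun_ltr.
  apply: measurable_funM => //; apply: measurableT_comp => //.
  by apply: measurableT_comp => //; exact: measurable_funM.
have If p : `](2^-1 : R), 2[%classic p -> mu.-integrable setT (EFin \o f p).
  rewrite /= in_itv /= => /andP[p1 _].
  have p0 : 0 < p by lra.
  apply: le_integrable (rgamma_kernel_integrable a0 p0) => //.
    by apply/measurable_EFinP; exact: mf.
  move=> r _; rewrite /= lee_fin /f /rgamma_kernel; case: ifPn => r0 //.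
  by rewrite !normrM [`|expR (ln _ * _)|]ger0_norm ?expR_ge0// ler_wpM2r// gb.
have df p r : is_derive p 1 (f ^~ r) (if 0 < r then - (r * g r) * expR (- (p * r)) else 0).
  rewrite /f; case: ifPn => r0; last exact: is_derive_cst.
  by apply: is_derive_eq; rewrite /GRing.scale /=; ring.
have d1f p r : partial1of2 f p r = if 0 < r then - (r * g r) * expR (- (p * r)) else 0.
  by rewrite partial1of2E; have [_ <-] := df p r.
have half0 : 0 < 2^-1 :> R by lra.
have a10 : 0 < a + 1 by lra.
have bd (x y : R) : `](2^-1 : R), 2[%classic x -> setT y ->
    `|partial1of2 f x y| <= rgamma_kernel (a + 1) 2^-1 y.
  rewrite /= in_itv /= => /andP[x1 _] _; rewrite d1f /rgamma_kernel.
  case: ifPn => y0; last by rewrite normr0.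
  rewrite normrM normrN normrM [`|y|]gtr0_norm// [`|expR _|]ger0_norm ?expR_ge0//.
  have -> : expR (ln y * (a + 1 - 1)) = y * expR (ln y * (a - 1)).
    by rewrite -{2}(lnK y0) -expRD; congr expR; ring.
  apply: ler_pM; rewrite ?mulr_ge0 ?expR_ge0 ?(ltW y0)//.
    by rewrite ler_wpM2l ?(ltW y0)// gb.
  by rewrite ler_expR lerN2 ler_wpM2r// ltW.
have I1 : `](2^-1 : R), 2[%classic 1 by rewrite /= in_itv /=; lra.
have derf (x y : R) : `](2^-1 : R), 2[%classic x -> setT y -> derivable (f ^~ y) x 1.
  by move=> _ _; have [] := df x y.
have Ig := rgamma_kernel_integrable a10 half0.
have h1 := derivable_under_integral measurableT I1 If derf (@rgamma_kernel_ge0 _ _ _) Ig bd.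
have h2 := differentiation_under_integral measurableT I1 If derf
  (@rgamma_kernel_ge0 _ _ _) Ig bd.
split; first exact: h1.
rewrite -derive1E h2; apply: eq_Rintegral => r _.
by have := d1f 1 r; rewrite /partial1of2 => ->; rewrite mul1r.
Qed.

(** Differentiate at p = 1 the two sides of the scaling law: the integral gives
    - Gamma(z + 1) and p^(-z) Gamma(z) gives - z Gamma(z). *)
Lemma GammaS z : 0 < complex.Re z -> Gamma (z + 1) = z * Gamma z.
Proof.
move=> z0; have z10 : 0 < complex.Re (z + 1) by rewrite ReD /=; lra.
have near1 : \forall p \near (1 : R), 0 < p by exact: lt_nbhsr.
have dln : is_derive (1 : R) 1 (@ln R) 1.
  by apply: is_derive_eq (is_derive1_ln ltr01) _; rewrite invr1.
have r1 r : 0 < r -> r%:C * cpow r (z - 1) = cpow r (z + 1 - 1).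
  by move=> r0; rewrite -{1}(cpow1 r0) -cpowD; congr cpow; ring.
have KE p : 0 < p -> cintegral mu setT (gamma_kernel z p) = cpow p (- z) * Gamma z.
  exact: cintegral_gamma_kernel.
have [mR mI] : cmeasurable (fun r : R => cpow r (z - 1)) by exact: cmeasurable_cpow.
have nb r : Normc.normc (cpow r (z - 1)) <= expR (ln r * (complex.Re z - 1)).
  by rewrite normc_cpow ReD ReN.
have dR := laplace_derive z0 mR (fun r _ => le_trans (le_Re_normc _) (nb r)).
have dI := laplace_derive z0 mI (fun r _ => le_trans (le_Im_normc _) (nb r)).
have dcpow : is_derive (1 : R) 1 (fun p => complex.Re (cpow p (- z))) (- complex.Re z) /\
    is_derive (1 : R) 1 (fun p => complex.Im (cpow p (- z))) (- complex.Im z).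
  split.
  - under eq_fun do rewrite Re_cpow.
    apply: is_derive_eq; rewrite /GRing.scale /= ln1 !mul0r cos0 sin0 expR0 ReN; ring.
  - under eq_fun do rewrite Im_cpow.
    apply: is_derive_eq; rewrite /GRing.scale /= ln1 !mul0r cos0 sin0 expR0 ImN; ring.
case: dcpow => dcR dcI.
have r1R r : 0 < r -> r * complex.Re (cpow r (z - 1)) = complex.Re (cpow r (z + 1 - 1)).
  by move=> r0; rewrite -r1// [RHS]Re_realM.
have r1I r : 0 < r -> r * complex.Im (cpow r (z - 1)) = complex.Im (cpow r (z + 1 - 1)).
  by move=> r0; rewrite -r1// [RHS]Im_realM.
have eR : - complex.Re (Gamma (z + 1)) = complex.Re (- z * Gamma z).
  have d1 : is_derive (1 : R) 1 (fun p => complex.Re (cpow p (- z) * Gamma z))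
      (complex.Re (- z * Gamma z)).
    under eq_fun do rewrite ReM.
    apply: is_derive_eq; rewrite /GRing.scale /= !ReM !ReN !ImN; ring.
  have near2 : \forall p \near (1 : R), complex.Re (cpow p (- z) * Gamma z) =
      \int[mu]_r (if 0 < r then complex.Re (cpow r (z - 1)) * expR (- (p * r)) else 0).
    apply: filterS near1 => p p0; rewrite -KE// /cintegral /=.
    apply: eq_Rintegral => r _; rewrite /gamma_kernel; case: ifP => // _.
    by rewrite Re_Mreal.
  have [_ <-] := near_eq_is_derive near2 d1; have [_ ->] := dR.
  have -> : complex.Re (Gamma (z + 1)) = \int[mu]_r complex.Re (gamma_kernel (z + 1) 1 r).
    by rewrite GammaE.
  apply/esym; rewrite -[RHS]mulN1r.
  apply: etrans; last by apply: RintegralZl => //; exact: (gamma_kernel_integrable z10 ltr01).1.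
  apply: eq_Rintegral => r _; rewrite /gamma_kernel; case: ifP => [r0|_]; last by rewrite mulr0.
  by rewrite [in RHS]Re_Mreal r1R// mul1r mulN1r mulNr.
have eI : - complex.Im (Gamma (z + 1)) = complex.Im (- z * Gamma z).
  have d1 : is_derive (1 : R) 1 (fun p => complex.Im (cpow p (- z) * Gamma z))
      (complex.Im (- z * Gamma z)).
    under eq_fun do rewrite ImM.
    apply: is_derive_eq; rewrite /GRing.scale /= !ImM !ReN !ImN; ring.
  have near2 : \forall p \near (1 : R), complex.Im (cpow p (- z) * Gamma z) =
      \int[mu]_r (if 0 < r then complex.Im (cpow r (z - 1)) * expR (- (p * r)) else 0).
    apply: filterS near1 => p p0; rewrite -KE// /cintegral /=.
    apply: eq_Rintegral => r _; rewrite /gamma_kernel; case: ifP => // _.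
    by rewrite Im_Mreal.
  have [_ <-] := near_eq_is_derive near2 d1; have [_ ->] := dI.
  have -> : complex.Im (Gamma (z + 1)) = \int[mu]_r complex.Im (gamma_kernel (z + 1) 1 r).
    by rewrite GammaE.
  apply/esym; rewrite -[RHS]mulN1r.
  apply: etrans; last by apply: RintegralZl => //; exact: (gamma_kernel_integrable z10 ltr01).2.
  apply: eq_Rintegral => r _; rewrite /gamma_kernel; case: ifP => [r0|_]; last by rewrite mulr0.
  by rewrite [in RHS]Im_Mreal r1I// mul1r mulN1r mulNr.
apply: oppr_inj; rewrite -[RHS]mulNr.
by apply: complex_eq; [rewrite -eR ReN|rewrite -eI ImN].
Qed.

End GammaFunction.

Section GammaNonzero.
Context {R : realType}.
Let mu := @lebesgue_measure R.
Implicit Types (z : R[i]) (a p r x : R).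

Definition rGamma a : R := \int[mu]_r rgamma_kernel a 1 r.

Lemma Gamma_real a : 0 < a -> Gamma a%:C = (rGamma a)%:C.
Proof.
move=> a0; rewrite GammaE// /cintegral; apply: complex_eq => /=.
  by apply: eq_Rintegral => r _; rewrite gamma_kernel_real.
transitivity (\int[mu]_(r in setT) (0 : R)).
  by apply: eq_Rintegral => r _; rewrite gamma_kernel_real.
by apply: etrans (Rintegral_cst _ _ _) _ => //; rewrite mul0r.
Qed.

Lemma rGammaS a : 0 < a -> rGamma (a + 1) = a * rGamma a.
Proof.
move=> a0; apply: complexI; rewrite rmorphM /=.
have <- := Gamma_real a0; have <- := @Gamma_real (a + 1) (addr_gt0 a0 ltr01).
by rewrite rmorphD /= GammaS.
Qed.

(** A lower bound on [1, 2] is enough. *)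
Lemma rGamma_gt0 a : 0 < a -> 0 < rGamma a.
Proof.
move=> a0; pose c := expR (- `|a - 1| - 2).
have Ik := rgamma_kernel_integrable a0 ltr01.
apply: (@lt_le_trans _ _ c); first exact: expR_gt0.
rewrite /rGamma -lee_fin /Rintegral fineK; last exact: (integrable_fin_num measurableT Ik).
apply: (@le_trans _ _ (\int[mu]_(r in `[1%R, 2%R]) (rgamma_kernel a 1 r)%:E)%E); last first.
  apply: ge0_subset_integral => //; first exact: (measurable_int _ Ik).
  by move=> r _; rewrite lee_fin rgamma_kernel_ge0.
have -> : c%:E = (\int[mu]_(r in `[1%R, 2%R]) c%:E)%E.
  rewrite integral_cst//= lebesgue_measure_itv /= lte_fin ltr1n.
  by rewrite -EFinB (_ : 2 - 1 = 1 :> R) ?mule1//; lra.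
apply: ge0_le_integral => //.
- by move=> r _; rewrite lee_fin expR_ge0.
- by apply: measurable_funTS; exact: (measurable_int _ Ik).
- move=> r; rewrite /= in_itv /= => /andP[r1 r2].
  have r0 : 0 < r by lra.
  rewrite lee_fin /rgamma_kernel r0 /c expRD; apply: ler_pM; rewrite ?expR_ge0//.
    rewrite ler_expR lerNl; apply: le_trans (ler_norm _) _.
    rewrite normrN normrM ger0_norm ?ln_ge0// ler_piMl//.
    have h : ln (1 + (r - 1)) <= r - 1 by apply: le_ln1Dx; lra.
    by rewrite [1 + _]addrC subrK in h; lra.
  by rewrite ler_expR mul1r lerN2.
Qed.

Lemma Gamma_pochhammer z n : 0 < complex.Re z ->
  Gamma (z + n%:R) = pochhammer z n * Gamma z.
Proof.
move=> z0; rewrite /pochhammer; elim: n => [|n IH].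
  by rewrite addr0 big_ord0 mul1r.
rewrite big_ord_recr /= -natr1 addrA GammaS; last first.
  by rewrite ReD Re_nat ltr_pwDl.
by rewrite IH mulrA [_ * \prod_(_ < _) _]mulrC.
Qed.

(** The right-hand side is 4 (exp(x/2) - exp(-x/2))^2, and the inner difference
    is at least x/2 in absolute value. *)
Lemma sqr_le_expR x : x ^+ 2 <= 4 * (expR x - 2 + expR (- x)).
Proof.
wlog x0 : x / 0 <= x => [hw|].
  have [|x0] := leP 0 x; first exact: hw.
  have := hw (- x); rewrite sqrrN opprK oppr_ge0 => /(_ (ltW x0)).
  by rewrite addrAC [expR (- x) + _]addrC addrAC.
pose u := x / 2; have u0 : 0 <= u by rewrite divr_ge0.
have ux : x = u + u by rewrite /u; lra.
have E1 := expR_ge1Dx u; have E2 : expR (- u) * expR u = 1 by rewrite mulrC expRxMexpNx_1.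
have P1 := expR_gt0 (- u).
have -> : - x = - u + - u by rewrite ux opprD.
rewrite [in leLHS]ux [in expR x]ux !expRD.
have B1 : expR (- u) <= 1 by rewrite -[leRHS]expR0 ler_expR oppr_le0.
have h : u <= expR u - expR (- u) by lra.
have -> : expR u * expR u - 2 + expR (- u) * expR (- u) =
    (expR u - expR (- u)) ^+ 2 by rewrite sqrrB mulrC -E2; ring.
have h2 : u ^+ 2 <= (expR u - expR (- u)) ^+ 2 by rewrite ler_sqr ?nnegrE//; lra.
lra.
Qed.

Lemma sin_le x : `|sin x| <= `|x|.
Proof.
wlog x0 : x / 0 <= x => [hw|].
  have [|x0] := leP 0 x; first exact: hw.
  by have := hw (- x); rewrite sinN !normrN oppr_ge0 => /(_ (ltW x0)).
have cs : {within `[0, x]%classic, continuous (@sin R)}.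
  by apply: continuous_subspaceT; exact: continuous_sin.
have [c _] := MVT_segment x0 (fun y _ => is_derive_sin y) cs.
rewrite sin0 !subr0 => ->; rewrite normrM ler_piMl//; exact: cos_max.
Qed.

Lemma cos_ge x : 1 - x ^+ 2 / 2 <= cos x.
Proof.
have -> : x = x / 2 + x / 2 by lra.
rewrite cosD -!expr2 cos2sin2.
have := sin_le (x / 2); rewrite -ler_sqr ?nnegrE// !real_normK ?num_real// => h.
nra.
Qed.

End GammaNonzero.

Section GammaNonzero.
Context {R : realType}.
Let mu := @lebesgue_measure R.
Implicit Types (z : R[i]) (a p r x : R).

(** Write X = Re z, y = Im z and th = y ln(r / X). Then Re (X^(-iy) Gamma(z)) is
    the integral of cos(th) against r^(X-1) exp(-r). The estimates
    cos(th) >= 1 - th^2 / 2 and ln(r/X)^2 <= 4 (r/X - 2 + X/r) bound it below by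
    Gamma(X) (1 - 2 y^2 / (X - 1)), because the moments of r and 1/r are known
    from the functional equation. *)
Lemma Gamma_neq0_far z : 1 < complex.Re z ->
  2 * complex.Im z ^+ 2 < complex.Re z - 1 -> Gamma z != 0.
Proof.
set X := complex.Re z; set y := complex.Im z => X1 yX.
have X0 : 0 < X by lra.
have X10 : 0 < X - 1 by lra.
pose W := cpow X (0 +i* - y).
(* The lower bound for the integrand, expressed with the kernels of exponents
   X, X + 1 and X - 1 so that its integral is explicit. *)
pose b r := (1 + 4 * y ^+ 2) * rgamma_kernel X 1 r -
  (2 * y ^+ 2 / X) * rgamma_kernel (X + 1) 1 r - (2 * y ^+ 2 * X) * rgamma_kernel (X - 1) 1 r.
have IX := rgamma_kernel_integrable X0 ltr01.
have IX1 : mu.-integrable setT (EFin \o rgamma_kernel (X + 1) 1).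
  by apply: rgamma_kernel_integrable => //; lra.
have IXm := rgamma_kernel_integrable X10 ltr01.
have Z1 c a : mu.-integrable setT (EFin \o rgamma_kernel a 1) ->
    mu.-integrable setT (EFin \o (fun r => c * rgamma_kernel a 1 r)).
  by move=> I; exact: (integrableZl measurableT c I).
have Ib : mu.-integrable setT (EFin \o b).
  exact: (integrableB measurableT (integrableB measurableT (Z1 _ _ IX) (Z1 _ _ IX1))
    (Z1 _ _ IXm)).
have intb : \int[mu]_r b r = rGamma X * (1 - 2 * y ^+ 2 / (X - 1)).
  have Z2 c a : mu.-integrable setT (EFin \o rgamma_kernel a 1) ->
      \int[mu]_r (c * rgamma_kernel a 1 r) = c * rGamma a.
    by move=> I; apply: RintegralZl.
  have -> : \int[mu]_r b r = (1 + 4 * y ^+ 2) * rGamma X -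
     (2 * y ^+ 2 / X) * rGamma (X + 1) - (2 * y ^+ 2 * X) * rGamma (X - 1).
    have J : mu.-integrable setT (EFin \o (fun r => (1 + 4 * y ^+ 2) * rgamma_kernel X 1 r -
        (2 * y ^+ 2 / X) * rgamma_kernel (X + 1) 1 r)).
      exact: (integrableB measurableT (Z1 _ _ IX) (Z1 _ _ IX1)).
    rewrite -!Z2// /b (RintegralB _ J)//; last exact: Z1.
    by rewrite RintegralB//; exact: Z1.
  have EX := rGammaS X0.
  rewrite EX (_ : rGamma X = (X - 1) * rGamma (X - 1)); last first.
    by rewrite -rGammaS// subrK.
  by field; rewrite !gt_eqF.
apply/eqP => G0.
have : complex.Re (W * Gamma z) = 0 by rewrite G0 mulr0.
rewrite GammaE// -cintegralZl ?cintegral_Re; last exact: gamma_kernel_integrable.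
apply/eqP; rewrite gt_eqF//.
apply: (@lt_le_trans _ _ (\int[mu]_r b r)).
  rewrite intb mulr_gt0 ?rGamma_gt0// subr_gt0 ltr_pdivrMr// mul1r//.
apply: le_Rintegral => //.
  exact: (cintegrableZl W (gamma_kernel_integrable X0 ltr01)).1.
move=> r _; rewrite /b /rgamma_kernel /gamma_kernel; case: ifPn => [r0|_]; last first.
  by rewrite !mulr0 !subr0.
rewrite (mulrA W) Re_Mreal ReM !Re_cpow !Im_cpow /=.
rewrite mulr0 expR0 !mul1r ReD ImD ReN ImN /= oppr0 addr0.
rewrite -/X -/y.
pose th := y * (ln r - ln X).
have -> : cos (ln X * - y) * (expR (ln r * (X - 1)) * cos (ln r * y)) -
    sin (ln X * - y) * (expR (ln r * (X - 1)) * sin (ln r * y)) =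
    expR (ln r * (X - 1)) * cos th.
  rewrite (_ : th = ln X * - y + ln r * y); last by rewrite /th; ring.
  by rewrite cosD; ring.
have -> : expR (ln r * (X + 1 - 1)) = r * expR (ln r * (X - 1)).
  by rewrite -{2}(lnK r0) -expRD; congr expR; ring.
have -> : expR (ln r * (X - 1 - 1)) = r^-1 * expR (ln r * (X - 1)).
  by rewrite -{2}(lnK r0) -expRN -expRD; congr expR; ring.
have key : 1 - 2 * y ^+ 2 * (r / X - 2 + X / r) <= cos th.
  apply: le_trans (cos_ge th).
  have := sqr_le_expR (ln r - ln X); rewrite opprB !expRB !lnK ?posrE// => h.
  have : y ^+ 2 * (ln r - ln X) ^+ 2 <= y ^+ 2 * (4 * (r / X - 2 + X / r)).
    by rewrite ler_wpM2l// sqr_ge0.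
  rewrite /th exprMn; lra.
have Ee : 0 <= expR (ln r * (X - 1)) * expR (- r) by rewrite mulr_ge0 ?expR_ge0.
apply: le_trans (le_trans (ler_wpM2l Ee key) _); last by rewrite mulrAC.
rewrite le_eqVlt; apply/orP; left; apply/eqP; field.
by rewrite !gt_eqF.
Qed.

(** Gamma(z + n) = z (z + 1) ... (z + n - 1) Gamma(z), so a zero would propagate
    to the region covered by [Gamma_neq0_far]. *)
Lemma Gamma_neq0 z : 0 < complex.Re z -> Gamma z != 0.
Proof.
move=> z0; pose n := (Num.truncn (2 * complex.Im z ^+ 2)).+2.
have : Gamma (z + n%:R) != 0.
  have h := truncnS_gt (2 * complex.Im z ^+ 2).
  have hn : (n%:R : R) = (Num.truncn (2 * complex.Im z ^+ 2)).+1%:R + 1.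
    by rewrite natr1.
  have h0 : 0 <= 2 * complex.Im z ^+ 2 by rewrite mulr_ge0 ?sqr_ge0.
  have eR : complex.Re (z + n%:R) = complex.Re z + n%:R by rewrite ReD Re_nat.
  have eI : complex.Im (z + n%:R) = complex.Im z by rewrite ImD Im_nat addr0.
  by apply: Gamma_neq0_far; rewrite eR ?eI hn; lra.
by rewrite Gamma_pochhammer// mulf_eq0 negb_or => /andP[].
Qed.

End GammaNonzero.

(** * The Beta integral *)

Section BetaIntegral.
Context {R : realType}.
Let mu := @lebesgue_measure R.
Implicit Types (s z : R[i]) (a p r x v : R).

(** The factor r^(-1/2) from v -> v / sqrt(r). *)
Lemma integral_gauss_scale r : 0 < r ->
  (\int[mu]_v (expR (- (r * v ^+ 2)))%:E = (Num.sqrt pi * expR (ln r * - 2^-1))%:E)%E.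
Proof.
move=> r0; rewrite (@ge0_integral_affine _ (expR (ln r * - 2^-1)) 0) ?expR_gt0//.
- rewrite [RHS]EFinM [RHS]muleC -integralT_gauss; congr (_ * _)%E; apply: eq_integral => v _.
  rewrite addr0 exprMn expr2 -expRD mulrA -{1}(lnK r0) -expRD.
  by rewrite (_ : ln r + _ = 0) ?expR0 ?mul1r//; lra.
- apply/measurable_EFinP; apply: measurableT_comp; first exact: measurable_expR.
  by apply: measurableT_comp => //; apply: measurable_funM => //; exact: measurable_funX.
Qed.

Lemma rgamma_kernel_split a r v :
  rgamma_kernel a (1 + v ^+ 2) r = rgamma_kernel a 1 r * expR (- (r * v ^+ 2)).
Proof.
rewrite /rgamma_kernel; case: ifP => _; last by rewrite mul0r.
by rewrite -[in RHS]mulrA -[in RHS]expRD; congr (_ * expR _); ring.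
Qed.

Lemma rgamma_kernel_half a r : 0 < r -> 
  rgamma_kernel a 1 r * expR (ln r * - 2^-1) = rgamma_kernel (a - 2^-1) 1 r.
Proof.
move=> r0; rewrite /rgamma_kernel r0 -!expRD; congr expR; by field.
Qed.

(** Integrating in v first leaves sqrt(pi) times the Gamma kernel of exponent
    a - 1/2, whence the bound on a. *)
Lemma integrable_gauss_kernel a : 2^-1 < a ->
  (mu \x mu)%E.-integrable setT (EFin \o (fun q : R * R => rgamma_kernel a (1 + q.1 ^+ 2) q.2)).
Proof.
move=> a2; have a20 : 0 < a - 2^-1 by lra.
apply/integrable21ltyP.
  apply/measurable_EFinP; apply: measurable_rgamma_kernel => //.
  by apply: measurable_funD => //; exact: measurable_funX.
have I := rgamma_kernel_integrable a20 ltr01.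
have -> : (\int[mu]_r \int[mu]_v
      `|(EFin \o (fun q : R * R => rgamma_kernel a (1 + q.1 ^+ 2) q.2)) (v, r)| =
    \int[mu]_r (Num.sqrt pi * rgamma_kernel (a - 2^-1) 1 r)%:E)%E.
  apply: eq_integral => r _ /=.
  have [r0|r0] := ltP 0 r; last first.
    rewrite /rgamma_kernel ltNge r0 /= mulr0.
    by under eq_integral do rewrite normr0; rewrite integral0.
  under eq_integral => v _.
    rewrite ger0_norm ?rgamma_kernel_ge0// rgamma_kernel_split EFinM; over.
  rewrite ge0_integralZl//; last 2 first.
  - apply/measurable_EFinP; apply: measurableT_comp; first exact: measurable_expR.
    by apply: measurableT_comp => //; apply: measurable_funM => //; exact: measurable_funX.
  - by rewrite lee_fin rgamma_kernel_ge0.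
  rewrite integral_gauss_scale// -EFinM mulrCA rgamma_kernel_half//.
have /integrableP[_] : mu.-integrable setT
    (EFin \o (fun r => Num.sqrt pi * rgamma_kernel (a - 2^-1) 1 r)).
  exact: (integrableZl measurableT _ I).
apply: le_lt_trans; rewrite le_eqVlt; apply/orP; left; apply/eqP.
by apply: eq_integral => r _ /=; rewrite ger0_norm// mulr_ge0 ?rgamma_kernel_ge0 ?sqrtr_ge0.
Qed.

(** The power -2s of the Japanese bracket of v. *)
Definition japanese s v : R[i] := cpow (1 + v ^+ 2) (- s).

Definition beta_integral s : R[i] := cintegral mu setT (japanese s).

Lemma oneDsqr_gt0 v : 0 < 1 + v ^+ 2.
Proof. by rewrite ltr_pwDl// sqr_ge0. Qed.

Lemma normc_japanese s v :
  Normc.normc (japanese s v) = expR (ln (1 + v ^+ 2) * - complex.Re s).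
Proof. by rewrite normc_cpow ReN. Qed.

(** Obtained from the Gaussian kernel: integrating it in r gives this function
    times Gamma(a). *)
Lemma integrable_japanese a : 2^-1 < a ->
  mu.-integrable setT (EFin \o (fun v => expR (ln (1 + v ^+ 2) * - a))).
Proof.
move=> a2; have a0 : 0 < a by lra.
have I := integrable_fubini_F (integrable_gauss_kernel a2).
have G0 := rGamma_gt0 a0.
have I' : mu.-integrable setT (EFin \o (fun v => expR (ln (1 + v ^+ 2) * - a) * rGamma a)).
  apply: eq_integrable I => // v _; rewrite /fubini_F /=.
  have v0 := oneDsqr_gt0 v.
  have If := rgamma_kernel_integrable a0 v0.
  rewrite -[LHS]fineK; last exact: (integrable_fin_num measurableT If).
  congr EFin; apply: complexI.
  have -> : (expR (ln (1 + v ^+ 2) * - a) * rGamma a)%:C =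
      cintegral mu setT (gamma_kernel a%:C (1 + v ^+ 2)).
    by rewrite cintegral_gamma_kernel// Gamma_real// -rmorphN cpow_real -rmorphM.
  apply: complex_eq => /=.
    by apply: eq_Rintegral => r _; rewrite gamma_kernel_real.
  transitivity (\int[mu]_(r in setT) (0 : R)); last first.
    by apply: eq_Rintegral => r _; rewrite gamma_kernel_real.
  by apply/esym; apply: etrans (Rintegral_cst _ _ _) _ => //; rewrite mul0r.
apply: eq_integrable (integrableZl measurableT (rGamma a)^-1 I') => // v _ /=.
by rewrite -EFinM; congr EFin; field; exact: lt0r_neq0.
Qed.

Lemma japanese_measurable s : cmeasurable (japanese s).
Proof.
apply: cmeasurable_cpow.
by apply: measurable_funD => //; exact: measurable_funX.
Qed.

Lemma cintegrable_japanese s : 2^-1 < complex.Re s -> cintegrable mu (japanese s).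
Proof.
move=> s2; apply: (@cintegrable_le _ _ _ mu _
  (fun v => expR (ln (1 + v ^+ 2) * - complex.Re s))).
- exact: japanese_measurable.
- exact: integrable_japanese.
- by move=> v; rewrite normc_japanese.
Qed.

Lemma gamma_kernel_split s r v :
  gamma_kernel s (1 + v ^+ 2) r = gamma_kernel s 1 r * (expR (- (r * v ^+ 2)))%:C.
Proof.
rewrite /gamma_kernel; case: ifP => _; last by rewrite mul0r.
by rewrite -[in RHS]mulrA -rmorphM -[in RHS]expRD; congr (_ * (expR _)%:C); ring.
Qed.

Lemma integrable_gauss_scale r : 0 < r ->
  mu.-integrable setT (EFin \o (fun v => expR (- (r * v ^+ 2)))).
Proof.
move=> r0; apply/integrableP; split.
  apply/measurable_EFinP; apply: measurableT_comp; first exact: measurable_expR.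
  by apply: measurableT_comp => //; apply: measurable_funM => //; exact: measurable_funX.
under eq_integral do rewrite /= ger0_norm ?expR_ge0//.
by rewrite integral_gauss_scale// ltry.
Qed.

Lemma cintegral_real (f : R -> R) :
  cintegral mu setT (fun v => (f v)%:C) = (\int[mu]_v f v)%:C.
Proof.
rewrite /cintegral; congr (_ +i* _).
by apply: etrans (Rintegral_cst _ _ _) _ => //; rewrite mul0r.
Qed.

Lemma cintegrable_real (f : R -> R) :
  mu.-integrable setT (EFin \o f) -> cintegrable mu (fun v => (f v)%:C).
Proof. by move=> If; split => //; exact: integrable0. Qed.

Lemma cintegrable_gauss_kernel s r : cintegrable mu (fun v => gamma_kernel s (1 + v ^+ 2) r).
Proof.
have [r0|r0] := ltP 0 r; last first.
  under eq_fun do rewrite /gamma_kernel ltNge r0 /=.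
  by apply: (@cintegrable_real (fun=> 0)); exact: integrable0.
under eq_fun do rewrite gamma_kernel_split.
apply: cintegrableZl; apply: cintegrable_real; exact: integrable_gauss_scale.
Qed.

Lemma gamma_kernel_half s r : 0 < r ->
  gamma_kernel s 1 r * (expR (ln r * - 2^-1))%:C = gamma_kernel (s - 2^-1%:C) 1 r.
Proof.
move=> r0; rewrite /gamma_kernel r0 mulrAC; congr (_ * _).
have -> : (expR (ln r * - 2^-1))%:C = cpow r (- 2^-1)%:C by rewrite cpow_real.
by rewrite -cpowD; congr (cpow _ _); rewrite rmorphN; ring.
Qed.

(** The two orders of integration of r^(s-1) exp(- r (1 + v^2)). *)
Lemma Gamma_beta_integral_pi s : 2^-1 < complex.Re s ->
  Gamma s * beta_integral s = (Num.sqrt pi)%:C * Gamma (s - 2^-1%:C).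
Proof.
move=> s2; have s0 : 0 < complex.Re s by lra.
have s20 : 0 < complex.Re (s - 2^-1%:C) by rewrite ReD ReN /=; lra.
pose f (q : R * R) := gamma_kernel s (1 + q.1 ^+ 2) q.2.
have If : cintegrable (mu \x mu)%E f.
  apply: (@cintegrable_le _ _ _ (mu \x mu)%E _
    (fun q : R * R => rgamma_kernel (complex.Re s) (1 + q.1 ^+ 2) q.2)).
  - apply: cmeasurable_gamma_kernel => //.
    by apply: measurable_funD => //; exact: measurable_funX.
  - exact: integrable_gauss_kernel.
  - by move=> q; rewrite normc_gamma_kernel.
have e1 : cintegral (mu \x mu)%E setT f = Gamma s * beta_integral s.
  rewrite cintegral_fubini12//; last first.
    by move=> v; exact: (gamma_kernel_integrable s0 (oneDsqr_gt0 v)).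
  rewrite /beta_integral -cintegralZl; last exact: cintegrable_japanese.
  apply: eq_cintegral => v; rewrite /f /= cintegral_gamma_kernel// ?oneDsqr_gt0//.
  by rewrite mulrC.
rewrite -e1 cintegral_fubini21//; last first.
  by move=> r; exact: cintegrable_gauss_kernel.
rewrite GammaE// -cintegralZl; last exact: gamma_kernel_integrable.
apply: eq_cintegral => r; rewrite /f /=.
have [r0|r0] := ltP 0 r; last first.
  rewrite [gamma_kernel _ _ _]/gamma_kernel ltNge r0 /= mulr0.
  under eq_cintegral do rewrite /gamma_kernel ltNge r0 /=.
  by rewrite /cintegral /=; apply: complex_eq => /=;
    apply: etrans (Rintegral_cst _ _ _) _ => //; rewrite mul0r.
under eq_cintegral do rewrite gamma_kernel_split.
rewrite cintegralZl; last exact: (cintegrable_real (integrable_gauss_scale r0)).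
rewrite cintegral_real (_ : \int[mu]_v _ = Num.sqrt pi * expR (ln r * - 2^-1)); last first.
  by rewrite /Rintegral integral_gauss_scale.
by rewrite rmorphM mulrCA gamma_kernel_half.
Qed.

End BetaIntegral.

Section BetaFunction.
Context {R : realType}.
Let mu := @lebesgue_measure R.
Implicit Types (s z : R[i]) (a p r x v : R).

Lemma Gamma1 : Gamma (1 : R[i]) = 1.
Proof.
have e : rGamma (1 : R) = 1.
  rewrite /rGamma /Rintegral -[RHS]/(fine 1%E); congr fine.
  rewrite -(@integral_exponential_pdf R 1 ltr01).
  transitivity (\int[mu]_(r in `]0%R, +oo[) (expR (- r))%:E)%E.
    rewrite [RHS]integral_mkcond; apply: eq_integral => r _.
    rewrite /rgamma_kernel patchE; case: ifPn => r0.
      by rewrite mem_set /= ?in_itv /= ?r0// subrr mulr0 expR0 !mul1r.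
    by rewrite memNset//= in_itv /= andbT; exact/negP.
  rewrite integral_itv_obnd_cbnd; last first.
    apply/measurable_EFinP; apply: measurable_funTS.
    by apply: measurableT_comp; [exact: measurable_expR|].
  rewrite [LHS]integral_mkcond; apply: eq_integral => r _.
  by rewrite /exponential_pdf !patchE; case: ifP => // _; rewrite mul1r mulN1r.
by have := Gamma_real (@ltr01 R); rewrite e.
Qed.

Lemma beta_integral1 : beta_integral (1 : R[i]) = pi%:C.
Proof.
have e v : japanese 1 v = ((1 + v ^+ 2)^-1)%:C.
  rewrite /japanese -cpowVl ?oneDsqr_gt0// cpow1// invr_gt0; exact: oneDsqr_gt0.
rewrite /beta_integral; under eq_cintegral do rewrite e.
rewrite cintegral_real; congr (_%:C); rewrite /Rintegral.
rewrite ge0_symfun_integralT.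
- rewrite (_ : [set x | _] = `[0, +oo[%classic); last first.
    by apply/seteqP; split => x/=; rewrite in_itv/= andbT.
  have -> := @integral0y_oneDsqr R.
  by rewrite -EFinM /=; field.
- by move=> x; rewrite invr_ge0 ltW// oneDsqr_gt0.
- exact: continuous_oneDsqrV.
- by move=> x /=; rewrite sqrrN.
Qed.

(** The case s = 1 of [Gamma_beta_integral_pi], where P(1) is the arctangent
    integral pi. *)
Lemma Gamma_half : Gamma (1 / 2 : R[i]) = (Num.sqrt pi)%:C.
Proof.
have hf : (1 : R[i]) - 2^-1%:C = 1 / 2.
  by rewrite fmorphV rmorph_nat; field.
have h : 2^-1 < complex.Re (1 : R[i]) by rewrite /=; lra.
have := Gamma_beta_integral_pi h; rewrite Gamma1 mul1r beta_integral1 hf.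
have sp0 : (Num.sqrt (pi : R))%:C != 0.
  by apply/eqP => /complexI/eqP; rewrite gt_eqF// sqrtr_gt0 pi_gt0.
move=> E; apply: (mulfI sp0); rewrite -E -rmorphM -expr2 sqr_sqrtr//.
exact: pi_ge0.
Qed.

Lemma Gamma_beta_integral s : 2^-1 < complex.Re s ->
  Gamma s * beta_integral s = Gamma (1 / 2) * Gamma (s - 1 / 2).
Proof.
move=> s2; rewrite Gamma_beta_integral_pi// Gamma_half; congr (_ * Gamma (s - _)).
by rewrite fmorphV rmorph_nat div1r.
Qed.

Lemma BetaE s : 2^-1 < complex.Re s -> Beta (1 / 2) (s - 1 / 2) = beta_integral s.
Proof.
move=> s2; have G0 : Gamma s != 0 by apply: Gamma_neq0; lra.
rewrite /Beta -Gamma_beta_integral// (_ : 1 / 2 + _ = s); last by ring.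
by rewrite mulrAC divff// mul1r.
Qed.

Lemma beta_integral_pochhammer s n : 2^-1 < complex.Re s ->
  beta_integral (s + n%:R) = beta_integral s * pochhammer (s - 1 / 2) n / pochhammer s n.
Proof.
move=> s2; have s0 : 0 < complex.Re s by lra.
have sn : 2^-1 < complex.Re (s + n%:R).
  by rewrite ReD Re_nat; have := ler0n R n; lra.
have s20 : 0 < complex.Re (s - 1 / 2).
  have -> : 1 / 2 = (2^-1 : R)%:C by rewrite fmorphV rmorph_nat div1r.
  by rewrite ReD ReN /=; lra.
have G0 : Gamma s != 0 by exact: Gamma_neq0.
have Gn0 : Gamma (s + n%:R) != 0 by apply: Gamma_neq0; lra.
have := Gamma_beta_integral sn.
have -> : s + n%:R - 1 / 2 = s - 1 / 2 + n%:R by ring.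
move: Gn0; rewrite !Gamma_pochhammer// mulf_eq0 negb_or => /andP[p0 _].
move=> h; apply: (mulfI (mulf_neq0 p0 G0)); rewrite h.
have := Gamma_beta_integral s2 => h2.
rewrite mulrCA -h2; field. by rewrite p0.
Qed.

End BetaFunction.

(** * The identity theorem on a half-line *)

Section IdentityTheorem.
Context {R : realType}.
Implicit Types (c : nat -> R) (f : R -> R).

Lemma geometric_tail_le (q : R) n N : 0 <= q <= 2^-1 -> (n <= N)%N ->
  \sum_(n <= k < N) q ^+ k <= 2 * (q ^+ n - q ^+ N).
Proof.
move=> /andP[q0 q2]; elim: N => [|N IH].
  by rewrite leqn0 => /eqP ->; rewrite big_geq// subrr mulr0.
rewrite leq_eqVlt => /predU1P[->|]; first by rewrite big_geq// subrr mulr0.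
rewrite ltnS => nN; rewrite big_nat_recr//=.
apply: le_trans (lerD (IH nN) (lexx _)) _.
have : q * q ^+ N <= 2^-1 * q ^+ N by rewrite ler_wpM2r ?exprn_ge0.
rewrite exprS; lra.
Qed.

(** If all coefficients below n vanish, then |c n| |x|^n is at most the tail,
    which is O(|x|^(n+1)); let x tend to 0. *)
Lemma power_series_coef_eq0 c (r : R) : 0 < r ->
  (forall x, - r < x < 0 -> series (fun n => c n * x ^+ n) n @[n --> \oo] --> (0 : R)) ->
  forall n, c n = 0.
Proof.
move=> r0 c0; pose rho := r / 2; have rho0 : 0 < rho by rewrite divr_gt0.
(* The general term at - rho tends to 0, hence is bounded. *)
have [M M0 cM] : exists2 M, 0 < M & forall n, `|c n| * rho ^+ n <= M.
  have rr : - r < - rho < 0 by rewrite /rho; lra.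
  have : cvgn (series (fun n => c n * (- rho) ^+ n)).
    by apply/cvg_ex; exists 0; exact: c0.
  move=> /cvg_series_cvg_0 h.
  have /cvg_seq_bounded[M [_ hM]] : cvgn (fun n => c n * (- rho) ^+ n).
    by apply/cvg_ex; exists 0.
  exists (`|M| + 1) => [|n]; first by rewrite ltr_wpDl.
  have : `|c n * (- rho) ^+ n| <= `|M| + 1.
    by apply: hM => //; rewrite (le_lt_trans (ler_norm _))// ltrDl.
  by rewrite normrM normrX normrN (gtr0_norm rho0).
elim/ltn_ind => n IH; apply/eqP; rewrite -normr_eq0; apply/eqP.
pose C := 2 * M / rho ^+ n.+1.
have C0 : 0 < C by rewrite divr_gt0 ?mulr_gt0 ?exprn_gt0.
have bound h : 0 < h -> h < rho / 2 -> `|c n| <= C * h.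
  move=> h0 hrho; pose q := h / rho.
  have q0 : 0 < q by rewrite divr_gt0.
  have q2 : q <= 2^-1 by rewrite ler_pdivrMr//; lra.
  have hr : - r < - h < 0 by rewrite /rho in hrho; lra.
  have cv := c0 _ hr.
  have le N : (n < N)%N -> `|c n| * h ^+ n <=
      `|series (fun n => c n * (- h) ^+ n) N| + 2 * M * q ^+ n.+1.
    move=> nN; rewrite /series /=.
    rewrite (big_cat_nat (n := n)) //=; last exact: ltnW.
    rewrite [X in `|X + _|]big_nat_cond [X in `|X + _|]big1 ?add0r; last first.
      by move=> k /andP[/andP[_ kn] _]; rewrite IH ?mul0r.
    rewrite big_ltn//; set S := \sum_(_ <= _ < _) _.
    have hS : `|S| <= 2 * M * q ^+ n.+1.
      apply: le_trans (ler_norm_sum _ _ _) _.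
      apply: (@le_trans _ _ (\sum_(n.+1 <= k < N) M * q ^+ k)).
        apply: ler_sum => k _; rewrite normrM normrX normrN (gtr0_norm h0).
        rewrite /q expr_div_n mulrA ler_pdivlMr ?exprn_gt0// mulrAC.
        by rewrite ler_wpM2r ?exprn_ge0 ?(ltW h0).
      rewrite -mulr_sumr [2 * M]mulrC -mulrA ler_pM2l//.
      have q02 : 0 <= q <= 2^-1 by rewrite ltW.
      apply: le_trans (geometric_tail_le q02 nN) _.
      by rewrite ler_pM2l// lerBlDr lerDl exprn_ge0// ltW.
    have -> : `|c n| * h ^+ n = `|c n * (- h) ^+ n + S - S|.
      by rewrite addrK normrM normrX normrN (gtr0_norm h0).
    by apply: le_trans (ler_normB _ _) _; rewrite lerD2l.
  have lim : `|c n| * h ^+ n <= 2 * M * q ^+ n.+1.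
    have cv' : `|series (fun n => c n * (- h) ^+ n) N| + 2 * M * q ^+ n.+1
        @[N --> \oo] --> `|0 : R| + 2 * M * q ^+ n.+1.
      by apply: cvgD; [exact: cvg_norm|exact: cvg_cst].
    rewrite normr0 add0r in cv'; rewrite -(cvg_lim _ cv')//.
    apply: limr_ge; first by apply/cvg_ex; eexists; exact: cv'.
    by exists n.+1 => // N /= nN; exact: le.
  rewrite -(ler_pM2r (exprn_gt0 n h0)); apply: le_trans lim _.
  rewrite le_eqVlt; apply/orP; left; apply/eqP.
  by rewrite /C /q expr_div_n [h ^+ n.+1]exprS; field; rewrite expf_neq0// gt_eqF.
apply/eqP; rewrite eq_le normr_ge0 andbT leNgt; apply/negP => cn0.
pose h := Num.min (rho / 4) (`|c n| / (2 * C)).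
have h0 : 0 < h by rewrite lt_min !divr_gt0// mulr_gt0.
have h1 : h <= rho / 4 by rewrite ge_min lexx.
have h2 : h <= `|c n| / (2 * C) by rewrite ge_min lexx orbT.
have : `|c n| <= C * h by apply: bound => //; lra.
have : C * h <= C * (`|c n| / (2 * C)) by rewrite ler_pM2l.
have -> : C * (`|c n| / (2 * C)) = `|c n| / 2 by field; rewrite gt_eqF.
lra.
Qed.

(** Let T be the supremum of the x such that f vanishes on [0, x]. Near T the
    function is a power series that vanishes to the left of T, hence it is 0 also
    to the right of T, which is absurd. *)
Lemma real_analytic_eq0 f :
  (forall t0, 0 <= t0 -> exists c r, 0 < r /\
     forall t, `|t - t0| < r ->
       series (fun n => c n * (t - t0) ^+ n) n @[n --> \oo] --> f t) ->
  (exists2 d : R, 0 < d & forall t, 0 <= t < d -> f t = 0) ->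
  forall t, 0 <= t -> f t = 0.
Proof.
move=> fan [d d0 fd] t1 t10; apply/eqP; apply: contraT => ft1.
pose S : set R := [set T | 0 <= T /\ forall t, 0 <= t <= T -> f t = 0].
have S1 : S (d / 2).
  split=> [|t]; first by rewrite divr_ge0// ltW.
  by move=> /andP[t0 td]; apply: fd; rewrite t0/=; lra.
have Sub : ubound S t1.
  move=> T [T0 fT]; rewrite leNgt; apply/negP => t1T.
  by move: ft1; rewrite fT ?eqxx// t10 ltW.
have hS : has_sup S by split; [exists (d / 2)|exists t1].
pose T := sup S.
have Td : d / 2 <= T by apply: ub_le_sup => //; exists t1.
have T0 : 0 < T by lra.
have fT t : 0 <= t -> t < T -> f t = 0.
  move=> t0 tT; have eT : 0 < T - t by lra.
  have [T' [_ fT'] T'T] := sup_adherent eT hS.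
  by apply: fT'; rewrite t0 /=; rewrite -/T in T'T; lra.
have [c [r [r0 cf]]] := fan T (ltW T0).
pose r' := Num.min r T.
have r'0 : 0 < r' by rewrite lt_min r0.
have r'r : r' <= r by rewrite ge_min lexx.
have r'T : r' <= T by rewrite ge_min lexx orbT.
have c0 : forall n, c n = 0.
  apply: (power_series_coef_eq0 r'0) => x /andP[x1 x2].
  have xr : `|T + x - T| < r by rewrite addrAC subrr add0r ltr0_norm//; lra.
  by have := cf _ xr; rewrite addrAC subrr add0r fT//; lra.
have ST : S (T + r / 2).
  split=> [|t /andP[t0 tT]]; first by lra.
  have [tlt|tge] := ltP t T; first exact: fT.
  have tr : `|t - T| < r by rewrite ger0_norm; lra.
  have := cf _ tr; rewrite (_ : series _ = fun=> 0); last first.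
    by apply/funext => n; rewrite /series /= big1// => k _; rewrite c0 mul0r.
  by move=> h; apply: (cvg_unique _ h (cvg_cst 0)).
have : T + r / 2 <= T by apply: ub_le_sup => //; exists t1.
lra.
Qed.

End IdentityTheorem.

(** * Power series of the Euler integral *)

Section Expansion.
Context {R : realType}.
Let mu := @lebesgue_measure R.
Implicit Types (s z : R[i]) (a p r x v u t h : R).

Lemma exp_series x : series (fun n => x ^+ n / n`!%:R) n @[n --> \oo] --> expR x.
Proof. exact: (is_cvg_series_exp_coeff x). Qed.

Lemma exp_partial_sum_le x n : 0 <= x -> \sum_(0 <= k < n) x ^+ k / k`!%:R <= expR x.
Proof.
move=> x0; rewrite -(cvg_lim _ (@exp_series x))//.
apply: (@nondecreasing_cvgn_le _ (series (fun n => x ^+ n / n`!%:R))).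
- by apply: nondecreasing_series => k _ _; rewrite divr_ge0 ?exprn_ge0.
- by apply/cvg_ex; eexists; exact: exp_series.
Qed.

(** The variable of Euler's integral, as a function of u. *)
Definition weight u : R := (1 + u ^+ 2)^-1.

Lemma weight_gt0 u : 0 < weight u.
Proof. by rewrite invr_gt0 oneDsqr_gt0. Qed.

Lemma weight_le1 u : weight u <= 1.
Proof. by rewrite invf_le1 ?oneDsqr_gt0// lerDl sqr_ge0. Qed.

Lemma measurable_weight : measurable_fun setT weight.
Proof. by apply: continuous_measurable_fun; exact: continuous_oneDsqrV. Qed.

Definition Phi s t (q : R * R) : R[i] :=
  japanese s q.1 * gamma_kernel (2 * s - 1) (1 + t * weight q.1) q.2.

Definition Phi_term s t (n : nat) (q : R * R) : R[i] :=
  Phi s t q * ((- (q.2 * weight q.1)) ^+ n / n`!%:R)%:C.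

(** A bound for all partial sums of the expansion with increment h: since
    w <= 1, the factor exp(r |h| w) costs at most |h| in the scale of the kernel. *)
Definition Phi_bound s h (q : R * R) : R :=
  expR (ln (1 + q.1 ^+ 2) * - complex.Re s) *
  rgamma_kernel (2 * complex.Re s - 1) (1 - `|h|) q.2.

Lemma Re_2s1 s : complex.Re (2 * s - 1) = 2 * complex.Re s - 1.
Proof.
have -> : (2 : R[i]) = (2 : R)%:C by rewrite rmorph_nat.
by rewrite ReD ReN Re_realM.
Qed.

Lemma integrable_Phi_bound s h : 2^-1 < complex.Re s -> `|h| < 1 ->
  (mu \x mu)%E.-integrable setT (EFin \o Phi_bound s h).
Proof.
move=> s2 h1; apply: (integrable_prod (integrable_japanese s2)).
by apply: rgamma_kernel_integrable; lra.
Qed.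

Lemma Phi_measurable s t : cmeasurable (Phi s t).
Proof.
apply: cmeasurableM.
  apply: cmeasurable_cpow; apply: measurable_funD => //.
  exact: measurable_funX.
apply: cmeasurable_gamma_kernel => //; apply: measurable_funD => //.
by apply: measurable_funM => //; apply: measurableT_comp => //; exact: measurable_weight.
Qed.

Lemma Phi_term_measurable s t n : cmeasurable (Phi_term s t n).
Proof.
apply: cmeasurableM; first exact: Phi_measurable.
apply: cmeasurable_real; apply: measurable_funM => //; apply: measurable_funX.
apply: measurableT_comp => //; apply: measurable_funM => //.
by apply: measurableT_comp => //; exact: measurable_weight.
Qed.

Lemma normc_Phi s t q : Normc.normc (Phi s t q) =
  expR (ln (1 + q.1 ^+ 2) * - complex.Re s) *
  rgamma_kernel (2 * complex.Re s - 1) (1 + t * weight q.1) q.2.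
Proof. by rewrite Normc.normcM normc_japanese normc_gamma_kernel Re_2s1. Qed.

Lemma Phi_term_bound s t0 h q n : 0 <= t0 ->
  \sum_(0 <= k < n) Normc.normc ((h ^+ k)%:C * Phi_term s t0 k q) <= Phi_bound s h q.
Proof.
move=> t00; case: q => u r.
pose x := r * weight u * `|h|.
have [r0|r0] := ltP 0 r; last first.
  rewrite big1 => [|k _]; first by rewrite /Phi_bound /rgamma_kernel ltNge r0 /= mulr0.
  by rewrite !Normc.normcM normc_gamma_kernel /rgamma_kernel ltNge r0 /= mulr0 mul0r mulr0.
have x0 : 0 <= x by rewrite !mulr_ge0// ltW// weight_gt0.
have e k : Normc.normc ((h ^+ k)%:C * Phi_term s t0 k (u, r)) =
    Normc.normc (Phi s t0 (u, r)) * (x ^+ k / k`!%:R).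
  rewrite !Normc.normcM !normc_real mulrCA; congr (_ * _).
  rewrite normrM !normrX normrN normfV (normr_nat _ k`!) /x /=.
  rewrite (gtr0_norm (_ : 0 < r * weight u)) ?mulr_gt0 ?weight_gt0//.
  by rewrite !exprMn; ring.
under eq_bigr do rewrite e.
rewrite -mulr_sumr; apply: le_trans (ler_wpM2l (normc_ge0 _) (exp_partial_sum_le n x0)) _.
rewrite normc_Phi /Phi_bound /= -mulrA ler_wpM2l ?expR_ge0//.
rewrite /rgamma_kernel r0 -mulrA ler_wpM2l ?expR_ge0// -expRD ler_expR /x.
have w0 := weight_gt0 u; have w1 := weight_le1 u.
have A : 0 <= t0 * weight u * r by rewrite !mulr_ge0// ltW.
have B : r * weight u * `|h| <= r * `|h| by rewrite ler_wpM2r// ler_piMr// ltW.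
lra.
Qed.

Lemma Phi_series s t0 h q :
  ccvg (series (fun n => (h ^+ n)%:C * Phi_term s t0 n q)) (Phi s (t0 + h) q).
Proof.
case: q => u r.
have -> : Phi s (t0 + h) (u, r) = Phi s t0 (u, r) * (expR (- (r * weight u * h)))%:C.
  rewrite /Phi /= -mulrA; congr (_ * _); rewrite /gamma_kernel.
  case: ifP => _; last by rewrite mul0r.
  by rewrite -mulrA -rmorphM -expRD; congr (_ * (expR _)%:C); ring.
have -> : (fun n => (h ^+ n)%:C * Phi_term s t0 n (u, r)) =
    (fun n => Phi s t0 (u, r) * ((- (r * weight u * h)) ^+ n / n`!%:R)%:C).
  apply/funext => n; rewrite mulrCA -rmorphM; congr (_ * _%:C).
  by rewrite /= -!mulNr !exprMn; ring.
apply: ccvg_seriesZl.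
have -> : series (fun n => ((- (r * weight u * h)) ^+ n / n`!%:R)%:C : R[i]) =
    (fun n => (series (fun n => (- (r * weight u * h)) ^+ n / n`!%:R) n)%:C).
  by apply/funext => n; rewrite /series /= rmorph_sum.
exact: ccvg_real (@exp_series _).
Qed.

Lemma Phi_term_integrable s t0 n : 2^-1 < complex.Re s -> 0 <= t0 ->
  cintegrable (mu \x mu)%E (Phi_term s t0 n).
Proof.
(* A single term does not involve the increment; 1/2 is an arbitrary choice. *)
move=> s2 t00; have h1 : `|2^-1 : R| < 1 by rewrite ger0_norm; lra.
have I := integrable_Phi_bound s2 h1.
apply: (@cintegrable_le _ _ _ (mu \x mu)%E _ (fun q => 2 ^+ n * Phi_bound s 2^-1 q)).
- exact: Phi_term_measurable.
- exact: (integrableZl measurableT (2 ^+ n) I).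
- move=> q; have := @Phi_term_bound s t0 2^-1 q n.+1 t00.
  rewrite big_nat_recr//= => h.
  have {h} : Normc.normc ((2^-1 ^+ n)%:C * Phi_term s t0 n q) <= Phi_bound s 2^-1 q.
    by apply: le_trans h; rewrite lerDr sumr_ge0// => k _; exact: normc_ge0.
  rewrite Normc.normcM normc_real ger0_norm ?exprn_ge0// exprVn => h.
  by rewrite -ler_pdivrMl ?exprn_gt0.
Qed.

Definition Phi_integral s t : R[i] := cintegral (mu \x mu)%E setT (Phi s t).

(** Termwise integration of the exponential series in h. *)
Lemma Phi_integral_expansion s t0 h : 2^-1 < complex.Re s -> 0 <= t0 -> `|h| < 1 ->
  ccvg (series (fun n => (h ^+ n)%:C * cintegral (mu \x mu)%E setT (Phi_term s t0 n)))
    (Phi_integral s (t0 + h)).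
Proof.
move=> s2 t00 h1.
have -> : (fun n => (h ^+ n)%:C * cintegral (mu \x mu)%E setT (Phi_term s t0 n)) =
    (fun n => cintegral (mu \x mu)%E setT (fun q => (h ^+ n)%:C * Phi_term s t0 n q)).
  by apply/funext => n; rewrite cintegralZl//; exact: Phi_term_integrable.
apply: (@cintegral_series _ _ _ (mu \x mu)%E _ _ (Phi_bound s h)).
- move=> n; apply: cmeasurableM; first exact: cmeasurable_cst.
  exact: Phi_term_measurable.
- by move=> q; exact: Phi_series.
- exact: integrable_Phi_bound.
- by move=> q n; exact: Phi_term_bound.
Qed.

End Expansion.

Section Hypergeometric.
Context {R : realType}.
Let mu := @lebesgue_measure R.
Implicit Types (s z : R[i]) (a p r x v u t h : R).

(** Up to the factor P(s), the function 2F1(2s - 1, s - 1/2; s; -t); in the variable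
    w = weight u it is the integral of w^(s - 3/2) (1 - w)^(-1/2) (1 + t w)^(1 - 2s)
    over [0, 1]. *)
Definition euler2F1 s t : R[i] :=
  cintegral mu setT (fun u => japanese s u * cpow (1 + t * weight u) (1 - 2 * s)).

Lemma cintegral_prod (f g : R -> R[i]) : cintegrable mu f -> cintegrable mu g ->
  cintegral (mu \x mu)%E setT (fun q => f q.1 * g q.2) =
  cintegral mu setT f * cintegral mu setT g.
Proof.
move=> If Ig.
have Ifg : cintegrable (mu \x mu)%E (fun q : R * R => f q.1 * g q.2).
  apply: (@cintegrable_le _ _ _ (mu \x mu)%E _
    (fun q : R * R => Normc.normc (f q.1) * Normc.normc (g q.2))).
  - have [f1 f2] := cintegrable_measurable If.
    have [g1 g2] := cintegrable_measurable Ig.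
    apply: cmeasurableM; split.
    + exact: (measurableT_comp f1 measurable_fst).
    + exact: (measurableT_comp f2 measurable_fst).
    + exact: (measurableT_comp g1 measurable_snd).
    + exact: (measurableT_comp g2 measurable_snd).
  - exact: (integrable_prod (integrable_normc If) (integrable_normc Ig)).
  - by move=> q; rewrite Normc.normcM.
rewrite cintegral_fubini12//; last by move=> x; exact: (cintegrableZl (f x) Ig).
rewrite mulrC -cintegralZl//; apply: eq_cintegral => x /=.
by rewrite cintegralZl// mulrC.
Qed.

Lemma Re_2s1_gt0 s : 2^-1 < complex.Re s -> 0 < complex.Re (2 * s - 1).
Proof. by move=> s2; rewrite Re_2s1; lra. Qed.

Lemma weightD_gt0 t u : 0 <= t -> 0 < 1 + t * weight u.
Proof. by move=> t0; rewrite ltr_pwDl// mulr_ge0// ltW// weight_gt0. Qed.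

Lemma cintegrable_euler2F1 s t : 2^-1 < complex.Re s -> 0 <= t ->
  cintegrable mu (fun u => japanese s u * cpow (1 + t * weight u) (1 - 2 * s)).
Proof.
move=> s2 t0; apply: (@cintegrable_le _ _ _ mu _
  (fun v => expR (ln (1 + v ^+ 2) * - complex.Re s))).
- apply: cmeasurableM; first exact: japanese_measurable.
  apply: cmeasurable_cpow; apply: measurable_funD => //.
  by apply: measurable_funM => //; exact: measurable_weight.
- exact: integrable_japanese.
- move=> u; rewrite Normc.normcM normc_japanese normc_cpow ler_piMr ?expR_ge0//.
  rewrite -[leRHS]expR0 ler_expR -opprB ReN Re_2s1 mulrN oppr_le0.
  rewrite mulr_ge0//; last by lra.
  by rewrite ln_ge0// lerDl mulr_ge0// ltW// weight_gt0.
Qed.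

Lemma cintegrable_Phi s t : 2^-1 < complex.Re s -> 0 <= t ->
  cintegrable (mu \x mu)%E (Phi s t).
Proof.
move=> s2 t0; have := Phi_term_integrable 0 s2 t0.
have -> // : Phi_term s t 0 = Phi s t.
by apply/funext => q; rewrite /Phi_term expr0 divr1 mulr1.
Qed.

(** Integrating in r first recovers (1 + t w)^(1 - 2s) from its Gamma integral. *)
Lemma Phi_integralE s t : 2^-1 < complex.Re s -> 0 <= t ->
  Phi_integral s t = Gamma (2 * s - 1) * euler2F1 s t.
Proof.
move=> s2 t0; have a0 := Re_2s1_gt0 s2.
rewrite /Phi_integral cintegral_fubini12; last 2 first.
- exact: cintegrable_Phi.
- by move=> u; exact: (cintegrableZl (japanese s u) (gamma_kernel_integrable a0 (weightD_gt0 u t0))).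
rewrite /euler2F1 -cintegralZl; last exact: cintegrable_euler2F1.
apply: eq_cintegral => u; rewrite /Phi /= cintegralZl; last first.
  exact: (gamma_kernel_integrable a0 (weightD_gt0 u t0)).
rewrite cintegral_gamma_kernel ?weightD_gt0// opprB mulrA mulrC; congr (_ * _).
Qed.

(** At t0 = 0 the variables separate: w^n shifts the exponent s and r^n shifts
    the exponent of the Gamma kernel. *)
Lemma Phi_term0 s n q : Phi_term s 0 n q =
  ((- 1) ^+ n / n`!%:R)%:C * (japanese (s + n%:R) q.1 * gamma_kernel (2 * s - 1 + n%:R) 1 q.2).
Proof.
case: q => u r; rewrite /Phi_term /Phi /= mul0r addr0 /gamma_kernel.
case: ifP => r0; last by rewrite !(mulr0, mul0r).
have -> : japanese (s + n%:R) u = japanese s u * (weight u ^+ n)%:C.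
  rewrite /japanese opprD cpowD; congr (_ * _).
  by rewrite -cpowVl ?oneDsqr_gt0// cpow_nat// weight_gt0.
have -> : cpow r (2 * s - 1 + n%:R - 1) = cpow r (2 * s - 1 - 1) * (r ^+ n)%:C.
  by rewrite -cpow_nat// -cpowD; congr cpow; ring.
have -> : (- (r * weight u)) ^+ n = (- 1) ^+ n * r ^+ n * weight u ^+ n.
  by rewrite [LHS]exprNn exprMn mulrA.
by rewrite !rmorphM; ring.
Qed.

Lemma cintegral_Phi_term0 s n : 2^-1 < complex.Re s ->
  cintegral (mu \x mu)%E setT (Phi_term s 0 n) =
  Gamma (2 * s - 1) * beta_integral s * (((- 1) ^+ n)%:C *
   (pochhammer (2 * s - 1) n * pochhammer (s - 1 / 2) n / (pochhammer s n * n`!%:R))).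
Proof.
move=> s2; have a0 := Re_2s1_gt0 s2.
have sn : 2^-1 < complex.Re (s + n%:R).
  by rewrite ReD Re_nat; have := ler0n R n; lra.
have an : 0 < complex.Re (2 * s - 1 + n%:R).
  by rewrite ReD Re_nat; have := ler0n R n; lra.
have -> : Phi_term s 0 n = fun q => ((- 1) ^+ n / n`!%:R)%:C *
    (japanese (s + n%:R) q.1 * gamma_kernel (2 * s - 1 + n%:R) 1 q.2).
  by apply/funext => q; rewrite Phi_term0.
have Ij := cintegrable_japanese sn; have Ik := gamma_kernel_integrable an (@ltr01 R).
have n0 : (n`!%:R : R) != 0 by rewrite pnatr_eq0 -lt0n fact_gt0.
have I : cintegrable (mu \x mu)%E
    (fun q : R * R => japanese (s + n%:R) q.1 * gamma_kernel (2 * s - 1 + n%:R) 1 q.2).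
  have h := @Phi_term_integrable _ s 0 n s2 (lexx 0).
  have h2 := cintegrableZl (n`!%:R / (-1) ^+ n)%:C h.
  rewrite (_ : (fun q => _) = (fun q => (n`!%:R / (-1) ^+ n)%:C * Phi_term s 0 n q))//.
  have e : (n`!%:R / (- 1) ^+ n)%:C * ((- 1) ^+ n / n`!%:R)%:C = 1 :> R[i].
    have e1 : (n`!%:R / (- 1) ^+ n) * ((- 1) ^+ n / n`!%:R) = 1 :> R.
      by field; rewrite n0 signr_eq0.
    by rewrite -rmorphM e1.
  by apply/funext => q; rewrite Phi_term0 mulrA e mul1r.
rewrite cintegralZl// cintegral_prod// -/(beta_integral _) -GammaE//.
rewrite Gamma_pochhammer// beta_integral_pochhammer//.
rewrite fmorph_div rmorph_nat invfM; ring.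
Qed.

(** Both sides, times Gamma(2s - 1), are real-analytic in t >= 0, and they have
    the same power series about 0. *)
Lemma hypergeometric_integral s (F : R[i] -> R[i]) t :
  2^-1 < complex.Re s -> is_hyp2F1 (2 * s - 1) (s - 1 / 2) s F -> 0 <= t ->
  euler2F1 s t = beta_integral s * F (- t)%:C.
Proof.
move=> s2 [Fser Fan] t0; have a0 := Re_2s1_gt0 s2.
apply: (mulfI (Gamma_neq0 a0)); rewrite -Phi_integralE// mulrA.
apply/eqP; rewrite -subr_eq0; apply/eqP.
set G := Gamma _ * beta_integral s.
pose f x := Phi_integral s x - G * F (- x)%:C.
have f_an t0' : 0 <= t0' -> exists c r, 0 < r /\ forall x, `|x - t0'| < r ->
    ccvg (series (fun n => ((x - t0') ^+ n)%:C * c n)) (f x).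
  move=> t0'0.
  have dom : [set z : R[i] | ~ 1 <= z] (- t0')%:C.
    by rewrite /= -[1]/(1%:C) lecR => h; lra.
  have [u [r [r0 hu]]] := Fan _ dom.
  (* The radius is 1 for the integral and r for F; the sign comes from the
     argument - x of F. *)
  exists (fun n => cintegral (mu \x mu)%E setT (Phi_term s t0' n) - G * ((-1) ^+ n * u n)).
  exists (Num.min r 1); split=> [|x]; first by rewrite lt_min r0 ltr01.
  rewrite lt_min => /andP[xr x1].
  have h1 := Phi_integral_expansion s2 t0'0 x1.
  rewrite (_ : t0' + (x - t0') = x) in h1; last by ring.
  have h2 : ccvg (series (fun n => u n * ((- x)%:C - (- t0')%:C) ^+ n)) (F (- x)%:C).
    apply: has_sum_ccvg; apply: hu.
    by rewrite -rmorphB normc_def /= expr0n addr0 sqrtr_sqr ltcR -opprD normrN.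
  have h3 := ccvgB h1 (ccvg_seriesZl G h2).
  rewrite (_ : series _ = fun n => series (fun n => ((x - t0') ^+ n)%:C *
      cintegral (mu \x mu)%E setT (Phi_term s t0' n)) n -
    series (fun n => G * (u n * ((- x)%:C - (- t0')%:C) ^+ n)) n)//.
  apply/funext => n; rewrite /series /= -sumrB; apply: eq_bigr => k _.
  rewrite mulrBr; congr (_ - _).
  rewrite -rmorphB (_ : - x - - t0' = -1 * (x - t0')); last by ring.
  by rewrite rmorphM exprMn rmorphXn rmorphN1 /=; ring.
have f_0 x : 0 <= x < 1 -> f x = 0.
  move=> /andP[x0 x1]; apply/eqP; rewrite subr_eq0; apply/eqP.
  have xn : `|x| < 1 by rewrite ger0_norm.
  have h1 := Phi_integral_expansion s2 (lexx 0) xn; rewrite add0r in h1.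
  have h2 : ccvg (series (gauss_term (2 * s - 1) (s - 1 / 2) s (- x)%:C)) (F (- x)%:C).
    apply: has_sum_ccvg; apply: Fser.
    by rewrite normc_def /= expr0n addr0 sqrtr_sqr -[1]/(1%:C) ltcR normrN.
  apply: (ccvg_unique h1).
  rewrite (_ : (fun n => _) = fun n => G * gauss_term (2 * s - 1) (s - 1 / 2) s (- x)%:C n).
    exact: ccvg_seriesZl.
  apply/funext => n; rewrite cintegral_Phi_term0// /gauss_term -/G.
  have -> : (- x)%:C ^+ n = ((- 1) ^+ n)%:C * (x ^+ n)%:C :> R[i].
    by rewrite -rmorphXn -rmorphM -[in RHS]exprNn.
  by ring.
rewrite -/(f t).
apply: complex_eq.
- apply: (@real_analytic_eq0 _ (fun t => complex.Re (f t))) => //.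
  + move=> x x0; have [c [r [r0 h]]] := f_an x x0.
    exists (fun n => complex.Re (c n)), r; split=> // y /h[h1 _].
    apply: cvg_trans h1; apply: near_eq_cvg; apply: nearW => n.
    by rewrite /series /= Re_sum; apply: eq_bigr => k _; rewrite Re_realM mulrC.
  + by exists 1 => // x /f_0 ->.
- apply: (@real_analytic_eq0 _ (fun t => complex.Im (f t))) => //.
  + move=> x x0; have [c [r [r0 h]]] := f_an x x0.
    exists (fun n => complex.Im (c n)), r; split=> // y /h[_ h1].
    apply: cvg_trans h1; apply: near_eq_cvg; apply: nearW => n.
    by rewrite /series /= Im_sum; apply: eq_bigr => k _; rewrite Im_realM mulrC.
  + by exists 1 => // x /f_0 ->.
Qed.

End Hypergeometric.

(** * The integral over the plane *)

Section PlaneIntegral.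
Context {R : realType}.
Variables (s : R[i]) (B y1 y2 : R).
Hypotheses (s2 : 2^-1 < complex.Re s) (B0 : 0 < B) (y10 : 0 < y1) (y20 : 0 < y2).
Let mu := @lebesgue_measure R.

Definition Hbase (x1 x2 : R) : R :=
  1 + Normc.normc ((x1 +i* y1) * (x2 +i* y2) + B%:C) ^+ 2 / (4 * y1 * y2 * B).

Lemma HbaseE x1 x2 : Hbase x1 x2 =
  ((x1 ^+ 2 + y1 ^+ 2) * (x2 ^+ 2 + y2 ^+ 2) + 2 * B * (x1 * x2 + y1 * y2) + B ^+ 2)
    / (4 * y1 * y2 * B).
Proof.
rewrite /Hbase sqr_normcE !(ReD, ImD, ReM, ImM) /=; field.
by rewrite !gt_eqF.
Qed.

Let t : R := B / (y1 * y2).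
Let t0 : 0 < t. Proof. by rewrite divr_gt0// mulr_gt0. Qed.

Definition slope u : R := y2 * (1 + t * weight u).

Lemma slope_gt0 u : 0 < slope u.
Proof. by rewrite mulr_gt0// weightD_gt0// ltW. Qed.

(** The completed square, in the variables u = x1 / y1 and x2. *)
Lemma Hbase_factor x1 x2 : let u := y1^-1 * x1 in
  Hbase x1 x2 = (y1 * y2 / (4 * B)) * ((1 + u ^+ 2) * (1 + t * weight u) ^+ 2) *
    (1 + ((slope u)^-1 * x2 + B * x1 * weight u / (y1 ^+ 2 * slope u)) ^+ 2).
Proof.
move=> u; rewrite HbaseE.
have A0 : 0 < x1 ^+ 2 + y1 ^+ 2 by rewrite ltr_wpDl ?sqr_ge0// exprn_gt0.
have D0 : 0 < y2 * (x1 ^+ 2 + y1 ^+ 2) + B * y1 by rewrite addr_gt0 ?mulr_gt0.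
rewrite /slope /u /t.
have -> : weight (y1^-1 * x1) = y1 ^+ 2 / (x1 ^+ 2 + y1 ^+ 2).
  by rewrite /weight; field; rewrite !gt_eqF.
by field; rewrite (gt_eqF A0) (gt_eqF D0) !gt_eqF.
Qed.

Lemma Hbase_gt0 x1 x2 : 0 < Hbase x1 x2.
Proof.
by rewrite ltr_pwDl// divr_ge0 ?sqr_ge0// ltW// !mulr_gt0.
Qed.

(** The difference, over a common positive denominator, is a sum of B times
    squares; the constant on the left is the one for which the terms in x1 x2
    complete a square. *)
Lemma Hbase_ge x1 x2 :
  (y1 * y2) ^+ 2 / (2 * B * (B + 2 * (y1 * y2))) *
    ((1 + (y1^-1 * x1) ^+ 2) * (1 + (y2^-1 * x2) ^+ 2)) <= Hbase x1 x2.
Proof.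
set Y := y1 * y2; have Y0 : 0 < Y by rewrite mulr_gt0.
set p := x1 * x2.
have E0 : 0 < B + 2 * Y by rewrite addr_gt0 ?mulr_gt0.
rewrite HbaseE -subr_ge0.
set S := (x1 ^+ 2 + y1 ^+ 2) * (x2 ^+ 2 + y2 ^+ 2).
have hS : p ^+ 2 + Y ^+ 2 <= S.
  have -> : S = p ^+ 2 + Y ^+ 2 + ((x1 * y2) ^+ 2 + (y1 * x2) ^+ 2).
    by rewrite /S /p /Y; ring.
  by rewrite lerDl addr_ge0 ?sqr_ge0.
have -> : Y ^+ 2 / (2 * B * (B + 2 * Y)) * ((1 + (y1^-1 * x1) ^+ 2) * (1 + (y2^-1 * x2) ^+ 2))
   = S / (2 * B * (B + 2 * Y)).
  by rewrite /S /Y; field; rewrite !gt_eqF// mulr_gt0.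
have -> : (S + 2 * B * (x1 * x2 + y1 * y2) + B ^+ 2) / (4 * y1 * y2 * B) -
    S / (2 * B * (B + 2 * Y)) =
    (B * (S - p ^+ 2 - Y ^+ 2) + B * (p + (B + 2 * Y)) ^+ 2 + B * Y ^+ 2) /
    (4 * Y * B * (B + 2 * Y)).
  by rewrite /Y /p; field; rewrite !gt_eqF// mulr_gt0.
rewrite divr_ge0//; last by rewrite !mulr_ge0// ltW.
have hB : 0 <= B * (S - p ^+ 2 - Y ^+ 2) by rewrite mulr_ge0 ?(ltW B0)//; lra.
apply: addr_ge0; first apply: (addr_ge0 hB).
  by rewrite mulr_ge0 ?sqr_ge0 ?(ltW B0).
by rewrite mulr_ge0 ?sqr_ge0 ?(ltW B0).
Qed.

Definition Hplane (q : R * R) : R[i] := cpow (Hbase q.1 q.2) (- s).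

Lemma measurable_Hbase : measurable_fun setT (fun q : R * R => Hbase q.1 q.2).
Proof.
have m1 : measurable_fun setT (fun q : R * R => q.1) by exact: measurable_fst.
have m2 : measurable_fun setT (fun q : R * R => q.2) by exact: measurable_snd.
under eq_fun do rewrite HbaseE.
apply: measurable_funM => //.
apply: measurable_funD => //; apply: measurable_funD.
  by apply: measurable_funM; apply: measurable_funD => //; exact: measurable_funX.
apply: measurable_funM => //; apply: measurable_funD => //.
exact: measurable_funM.
Qed.

Let jap v : R := expR (ln (1 + v ^+ 2) * - complex.Re s).

Lemma integrable_Hplane : cintegrable (mu \x mu)%E Hplane.
Proof.
have [c [c0 cH]] : exists c, 0 < c /\ forall x1 x2, c *
    ((1 + (y1^-1 * x1) ^+ 2) * (1 + (y2^-1 * x2) ^+ 2)) <= Hbase x1 x2.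
  eexists; split; last by move=> x1 x2; exact: Hbase_ge.
  by rewrite divr_gt0 ?exprn_gt0 ?mulr_gt0 ?addr_gt0 ?mulr_gt0.
have k1 : 0 < y1^-1 by rewrite invr_gt0.
have k2 : 0 < y2^-1 by rewrite invr_gt0.
have I1 := integrable_affine 0 k1 (integrable_japanese s2).
have I2 := integrable_affine 0 k2 (integrable_japanese s2).
have I := integrable_prod I1 I2.
apply: (@cintegrable_le _ _ _ (mu \x mu)%E _ (fun q : R * R =>
  expR (ln c * - complex.Re s) * (jap (y1^-1 * q.1 + 0) * jap (y2^-1 * q.2 + 0)))).
- exact: (cmeasurable_cpow _ measurable_Hbase).
- exact: (integrableZl measurableT (expR (ln c * - complex.Re s)) I).
- move=> [x1 x2]; rewrite /Hplane normc_cpow ReN /= !addr0 /jap -!expRD ler_expR.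
  rewrite -!mulrDl -!lnM ?posrE ?mulr_gt0 ?oneDsqr_gt0//.
  apply: ler_wnM2r; first by rewrite oppr_le0 ltW// (lt_trans _ s2)// invr_gt0.
  rewrite ler_ln ?posrE ?mulr_gt0 ?oneDsqr_gt0 ?Hbase_gt0//.
Qed.

Lemma Hplane_section x1 : let u := y1^-1 * x1 in
  (fun x2 => Hplane (x1, x2)) = (fun x2 =>
    cpow (y1 * y2 / (4 * B)) (- s) * (japanese s u * cpow (1 + t * weight u) (- (2 * s))) *
    japanese s ((slope u)^-1 * x2 + B * x1 * weight u / (y1 ^+ 2 * slope u))).
Proof.
move=> u; apply/funext => x2; rewrite /Hplane /= Hbase_factor -/u.
have w0 : 0 < 1 + t * weight u by rewrite weightD_gt0// ltW.
have P1 := oneDsqr_gt0 u; have P2 : 0 < (1 + t * weight u) ^+ 2 by rewrite exprn_gt0.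
have P3 : 0 < y1 * y2 / (4 * B) by rewrite divr_gt0 ?mulr_gt0.
rewrite (cpowMl _ (mulr_gt0 P3 (mulr_gt0 P1 P2)) (oneDsqr_gt0 _)).
rewrite (cpowMl _ P3 (mulr_gt0 P1 P2)) (cpowMl _ P1 P2).
congr (_ * (_ * _) * _).
rewrite expr2 cpowMl// -cpowD; congr cpow; ring.
Qed.

Lemma cintegrable_section x1 : cintegrable mu (fun x2 => Hplane (x1, x2)).
Proof.
rewrite Hplane_section; apply: cintegrableZl.
apply: cintegrable_affine; last exact: cintegrable_japanese.
by rewrite invr_gt0 slope_gt0.
Qed.

Lemma cintegral_section x1 : let u := y1^-1 * x1 in
  cintegral mu setT (fun x2 => Hplane (x1, x2)) =
    y2%:C * cpow (y1 * y2 / (4 * B)) (- s) * beta_integral s *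
    (japanese s u * cpow (1 + t * weight u) (1 - 2 * s)).
Proof.
move=> u; have w0 : 0 < 1 + t * weight u by rewrite weightD_gt0// ltW.
have k0 : 0 < (slope u)^-1 by rewrite invr_gt0 slope_gt0.
have Ij := cintegrable_japanese s2.
rewrite Hplane_section -/u cintegralZl; last exact: cintegrable_affine.
set m := B * x1 * weight u / (y1 ^+ 2 * slope u).
have e : cintegral mu setT (fun x2 => japanese s ((slope u)^-1 * x2 + m)) =
    (slope u)%:C * beta_integral s.
  rewrite /beta_integral (cintegral_affine m k0 Ij) mulrA -rmorphM divff ?mul1r//.
  by rewrite gt_eqF// slope_gt0.
have es : (slope u)%:C = y2%:C * cpow (1 + t * weight u) 1 by rewrite cpow1// -rmorphM.
rewrite e es.
rewrite cpowD; ring.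
Qed.

Lemma cintegral_Hplane :
  cintegral (mu \x mu)%E setT Hplane =
  (y1 * y2)%:C * cpow (y1 * y2 / (4 * B)) (- s) * beta_integral s * euler2F1 s t.
Proof.
have k0 : 0 < y1^-1 by rewrite invr_gt0.
have IG := cintegrable_euler2F1 s2 (ltW t0).
rewrite cintegral_fubini12; last 2 first.
- exact: integrable_Hplane.
- exact: cintegrable_section.
under eq_cintegral do rewrite cintegral_section -[y1^-1 * _]addr0.
rewrite cintegralZl; last exact: (cintegrable_affine 0 k0 IG).
rewrite /euler2F1 (cintegral_affine 0 k0 IG).
rewrite rmorphM fmorphV; field.
by apply/eqP => /complexI /eqP; rewrite gt_eqF.
Qed.

End PlaneIntegral.

(** * The constant Fourier coefficient *)

(** The character is trivial at nu = 0. *)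
Lemma btilde0E (R : realType) (K : fieldExtType rat)
    (iota iota' : {rmorphism K -> R}) (D : int) (b : set K) (s : R[i]) (B y1 y2 : R) :
  btilde iota iota' D b s B 0 y1 y2 = (vol iota iota' D b)^-1%:C *
    cintegral (@lebesgue_measure R \x @lebesgue_measure R)%E setT (Hplane s B y1 y2).
Proof.
rewrite /btilde; congr (_ * _); apply: eq_cintegral => q.
rewrite /tr !rmorph0 !mul0r addr0 oppr0 /e mulr0 cexp0 mulr1.
by rewrite /Hterm /Hplane /Hbase.
Qed.

Theorem lemma4p4 (R : realType) (K : fieldExtType rat)
    (iota iota' : {rmorphism K -> R}) (D : int) (b : set K)
    (B : R) (s : R[i]) (y1 y2 : R) (F : R[i] -> R[i])
    (dimK : \dim {:K} = 2%N)
    (iota_neq : ~ (iota =1 iota'))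
    (discD : is_discriminant iota iota' D)
    (idealb : fractional_ideal b)
    (B_gt0 : 0 < B) (y1_gt0 : 0 < y1) (y2_gt0 : 0 < y2)
    (s_gt : 1 / 2 < complex.Re s)
    (* F is the hypergeometric function 2F1(2s - 1, s - 1/2; s; .) *)
    (hypF : is_hyp2F1 (2 * s - 1) (s - 1 / 2) s F) :
  btilde iota iota' D b s B 0 y1 y2 =
    cpow (4 * B) s * cpow (y1 * y2) (1 - s) * Beta (1 / 2) (s - 1 / 2) ^+ 2
      / (vol iota iota' D b)%:C
    * F (- (B / (y1 * y2)))%:C.
Proof.
have s2 : 2^-1 < complex.Re s by rewrite div1r in s_gt.
have Y0 : 0 < y1 * y2 by rewrite mulr_gt0.
have t0 : 0 <= B / (y1 * y2) by rewrite ltW// divr_gt0.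
have B40 : 0 < 4 * B by rewrite mulr_gt0.
rewrite btilde0E cintegral_Hplane// (hypergeometric_integral s2 hypF t0) BetaE//.
rewrite cpowMl ?invr_gt0// cpowVl// opprK cpowD cpow1// fmorphV; ring.
Qed.
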